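(* Let $\alpha\in Q^+$ with $|\alpha|=d$. (1) For all $\mathbf i,\mathbf j\in\mathrm{Seq}(\alpha)$, the set ${}_{\mathbf j}B(\alpha)_{\mathbf i}=\{\tau_{\underline w}\,x_1^{t_1}\cdots x_d^{t_d}1_{\mathbf i}: (t_1,\dots,t_d)\in\mathbb{Z}_{\ge0}^d,\ w\in S_d,\ w(\mathbf i)=\mathbf j\}$ is a homogeneous basis of the $\mathbb{F}$-vector space $1_{\mathbf j}R(\alpha)1_{\mathbf i}$. (2) $\mathfrak{Pol}(\alpha)$ is a faithful representation of $R(\alpha)$.
   Context: **Datum.** $I$ is a countable index set and $A=(a_{ij})_{i,j\in I}$ is an integer matrix with $a_{ii}=2$ or $a_{ii}\in 2\mathbb{Z}_{\le 0}$, $a_{ij}\le 0$ for $i\ne j$, $a_{ij}=0\iff a_{ji}=0$. $I^{re}=\{i:a_{ii}=2\}$. Positive integers $s_i$ with $s_ia_{ij}=s_ja_{ji}$ are fixed. $\alpha_i$ ($i\in I$) are linearly independent simple roots, $(\alpha_i|\alpha_j)=s_ia_{ij}$, $Q^+=\sum\mathbb{Z}_{\ge0}\alpha_i$, $|\alpha|=\sum k_i$ for $\alpha=\sum k_i\alpha_i\in Q^+$. **KLR algebra.** $\mathbb{F}$ is a field. Fix $\mathcal{Q}_{i,j}(u,v)\in\mathbb{F}[u,v]$ with $\mathcal{Q}_{i,j}(u,v)=\mathcal{Q}_{j,i}(v,u)$, $\mathcal{Q}_{i,i}=0$, and for $i\neq j$, $\mathcal{Q}_{i,j}=\sum t_{i,j;p,q}u^pv^q$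 over $p,q\ge 0$ with $(\alpha_i|\alpha_j)+s_ip+s_jq=0$, where $t_{i,j;-a_{ij},0}\in\mathbb{F}^\times$. Fix $\mathcal{P}_i(u,v)=\sum h_{i;p,q}u^pv^q$, the sum over $p,q\ge0$ with $p+q=1-\frac{a_{ii}}2$, with $h_{i;1-a_{ii}/2,0},h_{i;0,1-a_{ii}/2}\in\mathbb{F}^\times$; $\mathcal{P}_i=1$ for $i\in I^{re}$. For $\alpha\in Q^+$, $|\alpha|=d$, let $\mathrm{Seq}(\alpha)=\{\mathbf{i}=(i_1\ldots i_d)\in I^d:\sum\alpha_{i_k}=\alpha\}$, with place-permutation action of $S_d=\langle r_1,\dots,r_{d-1}\rangle$ ($r_t$ swaps $i_t$ and $i_{t+1}$). $\partial_t(f)=\frac{r_tf-f}{x_t-x_{t+1}}$ on polynomials in $x_1,\dots,x_d$, where $r_t$ swaps $x_t,x_{t+1}$. $R(\alpha)$ is the graded $\mathbb{F}$-algebra generated by $1_{\mathbf i}$, $x_1,\dots,x_d$, $\tau_1,\dots,\tau_{d-1}$ with relations: $1_{\mathbf i}1_{\mathbf j}=\delta_{\mathbf i\mathbf j}1_{\mathbf i}$, $\sum_{\mathbf i}1_{\mathbf i}=1$, $x_k1_{\mathbf i}=1_{\mathbf i}x_k$, $x_kx_l=x_lx_k$, $\tau_t1_{\mathbf i}=1_{r_t\mathbf i}\tau_t$, $\tau_t\tau_s=\tau_s\tau_t$ if $|t-s|>1$; $\tau_t^21_{\mathbf i}=\partial_t\mathcal{P}_{i_t}(x_t,x_{t+1})\tau_t1_{\mathbf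 i}$ if $i_t=i_{t+1}$ and $=\mathcal{Q}_{i_t,i_{t+1}}(x_t,x_{t+1})1_{\mathbf i}$ otherwise; $(\tau_tx_k-x_{r_t(k)}\tau_t)1_{\mathbf i}$ equals $-\mathcal{P}_{i_t}(x_t,x_{t+1})1_{\mathbf i}$ if $k=t,i_t=i_{t+1}$, $\mathcal{P}_{i_t}(x_t,x_{t+1})1_{\mathbf i}$ if $k=t+1,i_t=i_{t+1}$, and $0$ otherwise; $(\tau_{t+1}\tau_t\tau_{t+1}-\tau_t\tau_{t+1}\tau_t)1_{\mathbf i}$ equals $\mathcal{P}_{i_t}(x_t,x_{t+2})\overline{\mathcal Q}_{i_t,i_{t+1}}(x_t,x_{t+1},x_{t+2})1_{\mathbf i}$ if $i_t=i_{t+2}\ne i_{t+1}$, $\overline{\mathcal P}'_{i_t}(x_t,x_{t+1},x_{t+2})\tau_t1_{\mathbf i}+\overline{\mathcal P}''_{i_t}(x_t,x_{t+1},x_{t+2})\tau_{t+1}1_{\mathbf i}$ if $i_t=i_{t+1}=i_{t+2}$, and $0$ otherwise. Here $\overline{\mathcal Q}_{i,j}(u,v,w)=\frac{\mathcal Q_{i,j}(u,v)-\mathcal Q_{i,j}(w,v)}{u-w}$, $$\overline{\mathcal P}'_i(u,v,w)=\tfrac{\mathcal P_i(v,u)\mathcal P_i(u,w)}{(u-v)(u-w)}+\tfrac{\mathcal P_i(u,w)\mathcal P_i(v,w)}{(u-w)(v-w)}-\tfrac{\mathcal P_i(u,v)\mathcal P_i(v,w)}{(u-v)(v-w)},$$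 $$\overline{\mathcal P}''_i(u,v,w)=-\tfrac{\mathcal P_i(u,v)\mathcal P_i(u,w)}{(u-v)(u-w)}-\tfrac{\mathcal P_i(u,w)\mathcal P_i(w,v)}{(u-w)(v-w)}+\tfrac{\mathcal P_i(u,v)\mathcal P_i(v,w)}{(u-v)(v-w)}$$ (polynomials). Grading: $\deg1_{\mathbf i}=0$, $\deg x_k1_{\mathbf i}=2s_{i_k}$, $\deg\tau_t1_{\mathbf i}=-(\alpha_{i_t}|\alpha_{i_{t+1}})$. For each $w\in S_d$ a reduced expression $\underline w=r_{k_1}\cdots r_{k_l}$ is fixed and $\tau_{\underline w}=\tau_{k_1}\cdots\tau_{k_l}$. **Polynomial representation.** Fix a total order $\prec$ on $I$. $\mathfrak{Pol}(\alpha)=\bigoplus_{\mathbf i\in\mathrm{Seq}(\alpha)}\mathbb{F}[x_1(\mathbf i),\dots,x_d(\mathbf i)]$. For $f\in\mathbb{F}[u_1,\dots,u_d]$, $f(\mathbf i)$ is obtained by substituting $u_k=x_k(\mathbf i)$; operators $r_t$ and $\partial_t$ are applied to $f$ before substitution. $R(\alpha)$ acts by $1_{\mathbf j}\cdot f(\mathbf i)=\delta_{\mathbf i\mathbf j}f(\mathbf i)$, $x_k\cdot f(\mathbf i)=x_k(\mathbf i)f(\mathbf i)$, and $$\tau_t\cdot f(\mathbf i)=\begin{cases}\mathcal{P}_{i_t}(x_t(r_t\mathbf i),x_{t+1}(r_t\mathbf i))\,(\partial_tf)(r_t\mathbf i)&i_t=i_{t+1},\\ \mathcal{Q}_{i_{t+1},i_t}(x_t(r_t\mathbf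 i),x_{t+1}(r_t\mathbf i))\,(r_tf)(r_t\mathbf i)&i_t\succ i_{t+1},\\ (r_tf)(r_t\mathbf i)&i_t\prec i_{t+1}.\end{cases}$$ This is a well-defined $R(\alpha)$-module structure. *)

(* Defs.v *)
From HB Require Import structures.
From mathcomp Require Import all_boot all_order all_algebra all_fingroup.
From mathcomp Require Import generic_quotient ring_quotient fraction.
From mathcomp Require Import finmap multiset.
From mathcomp Require Import boolp.
From mathcomp.multinomials Require Import (canonicals, coercions) monalg.
From mathcomp.multinomials Require Import mpoly.

Set Implicit Arguments.
Unset Strict Implicit.
Unset Printing Implicit Defensive.

Import Order.TTheory GRing.Theory Num.Theory.
Local Open Scope mset_scope.
Local Open Scope ring_scope.

(* Algebras by generators and relations over F: the free algebra on X (the *)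
(* monoid algebra of the free monoid on X) modulo a two-sided ideal. *)

Section Presentation.

Variables (F : fieldType) (X : choiceType).

Definition free_alg := monalg.malg (monalg.fmonom X) F.

HB.instance Definition _ := GRing.Lalgebra.on free_alg.

Definition free_gen (g : X) : free_alg := monalg.mkmalgU (monalg.fmu g) 1.

Lemma free_scalerAr (c : F) (a b : free_alg) : c *: (a * b) = a * (c *: b).
Proof.
have mulC (x : free_alg) : x * monalg.mkmalgU monalg.mone c = c *: x.
  rewrite -monalg.mul_malgC [LHS]monalg.fgmulgU [RHS]monalg.fgmulUg.
  by apply: eq_bigr => k _; rewrite mulrC monalg.mulm1 monalg.mul1m.
by rewrite -[c *: b]monalg.mul_malgC mulrA mulC scalerAl.
Qed.

HB.instance Definition _ :=
  GRing.Lalgebra_isAlgebra.Build F free_alg free_scalerAr.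

Inductive ideal_of (S : free_alg -> Prop) : free_alg -> Prop :=
| IdealGen a of S a : ideal_of S a
| IdealZero : ideal_of S 0
| IdealAdd a b of ideal_of S a & ideal_of S b : ideal_of S (a + b)
| IdealMul a b c of ideal_of S b : ideal_of S (a * b * c).

(* The relations are the pairs (a, b) with rel a b, read as a = b. *)
Variable rel : free_alg -> free_alg -> Prop.

Definition rel_diff (z : free_alg) : Prop :=
  exists a b, rel a b /\ z = a - b.

Definition rel_ideal : pred free_alg := fun z => `[< ideal_of rel_diff z >].

Lemma rel_idealP z : reflect (ideal_of rel_diff z) (rel_ideal z).
Proof. exact: asboolP. Qed.

Fact rel_ideal_zmod_closed : zmod_closed rel_ideal.
Proof.
split=> [|a b]; first by apply/rel_idealP; exact: IdealZero.
move=> /rel_idealP Ia /rel_idealP Ib; apply/rel_idealP.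
apply: IdealAdd => //; rewrite -mulN1r -[_ * b]mulr1; exact: IdealMul.
Qed.

HB.instance Definition _ :=
  GRing.isZmodClosed.Build free_alg rel_ideal rel_ideal_zmod_closed.

Definition presented := Quotient.quot (GRing.ZmodClosed.clone free_alg rel_ideal _).

HB.instance Definition _ := EqQuotient.on presented.
HB.instance Definition _ := GRing.Zmodule.on presented.

Local Notation pi := (\pi_presented)%qT.

Lemma presented_eqP a b : reflect (ideal_of rel_diff (a - b)) (pi a == pi b).
Proof. by rewrite piE; exact: rel_idealP. Qed.

Fact pi_mul_compat a a' b b' :
  pi a = pi a' -> pi b = pi b' -> pi (a * b) = pi (a' * b').
Proof.
move=> /eqP/presented_eqP Ia /eqP/presented_eqP Ib; apply/eqP/presented_eqP.
have -> : a * b - a' * b' = 1 * (a - a') * b + a' * (b - b') * 1.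
  by rewrite mul1r mulr1 mulrBl mulrBr addrA subrK.
by apply: IdealAdd; apply: IdealMul.
Qed.

Fact pi_scale_compat c a a' : pi a = pi a' -> pi (c *: a) = pi (c *: a').
Proof.
rewrite -[c *: a]mulr_algl -[c *: a']mulr_algl.
exact: (pi_mul_compat (erefl (pi c%:A))).
Qed.

Definition presented_one : presented := lift_cst presented 1.
Definition presented_mul := lift_op2 presented *%R.
Definition presented_scale (c : F) := lift_op1 presented ( *:%R c).

Let pi_add a b : pi a + pi b = pi (a + b).
Proof. by symmetry; exact: Quotient.pi_add. Qed.

Let pi_mul a b : presented_mul (pi a) (pi b) = pi (a * b).
Proof. by unlock presented_mul; apply: pi_mul_compat; exact: reprK. Qed.

Let pi_scale c a : presented_scale c (pi a) = pi (c *: a).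
Proof. by unlock presented_scale; apply: pi_scale_compat; exact: reprK. Qed.

Let pi_one : presented_one = pi 1. Proof. by unlock presented_one. Qed.

Let pi_surj (u : presented) : exists a, u = pi a.
Proof. by exists (repr u); rewrite reprK. Qed.

Fact presented_mulA : associative presented_mul.
Proof.
move=> u v w; case: (pi_surj u) (pi_surj v) (pi_surj w) => a -> [b ->] [c ->].
by rewrite (pi_mul b c) (pi_mul a b) (pi_mul a) (pi_mul _ c) mulrA.
Qed.

Fact presented_mul1 : left_id presented_one presented_mul.
Proof. by move=> u; case: (pi_surj u) => a ->; rewrite pi_one (pi_mul 1 a) mul1r. Qed.

Fact presented_mulr1 : right_id presented_one presented_mul.
Proof. by move=> u; case: (pi_surj u) => a ->; rewrite pi_one (pi_mul a 1) mulr1. Qed.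

Fact presented_mulDl : left_distributive presented_mul +%R.
Proof.
move=> u v w; case: (pi_surj u) (pi_surj v) (pi_surj w) => a -> [b ->] [c ->].
by rewrite (pi_add a b) (pi_mul _ c) (pi_mul a c) (pi_mul b c) pi_add mulrDl.
Qed.

Fact presented_mulDr : right_distributive presented_mul +%R.
Proof.
move=> u v w; case: (pi_surj u) (pi_surj v) (pi_surj w) => a -> [b ->] [c ->].
by rewrite (pi_add b c) (pi_mul a _) (pi_mul a b) (pi_mul a c) pi_add mulrDr.
Qed.

HB.instance Definition _ := GRing.Zmodule_isPzRing.Build presented
  presented_mulA presented_mul1 presented_mulr1 presented_mulDl
  presented_mulDr.

Fact presented_scaleA c c' u :
  presented_scale c (presented_scale c' u) = presented_scale (c * c') u.
Proof.
case: (pi_surj u) => a ->.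
by rewrite (pi_scale c') (pi_scale c) (pi_scale (c * c')) scalerA.
Qed.

Fact presented_scale1 : left_id 1 presented_scale.
Proof. by move=> u; case: (pi_surj u) => a ->; rewrite pi_scale scale1r. Qed.

Fact presented_scaleDr : right_distributive presented_scale +%R.
Proof.
move=> c u v; case: (pi_surj u) (pi_surj v) => a -> [b ->].
by rewrite (pi_add a b) !(pi_scale c) pi_add scalerDr.
Qed.

Fact presented_scaleDl u :
  {morph presented_scale^~ u : c c' / c + c' >-> c + c'}.
Proof.
move=> c c'; case: (pi_surj u) => a ->.
by rewrite !pi_scale pi_add scalerDl.
Qed.

HB.instance Definition _ := GRing.Zmodule_isLmodule.Build F presented
  presented_scaleA presented_scale1 presented_scaleDr presented_scaleDl.

Definition presented_pi (a : free_alg) : presented := pi a.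

Fact presented_pi_zmod_morphism : zmod_morphism presented_pi.
Proof.
move=> a b; rewrite /presented_pi -[X in _ = _ + X](Quotient.pi_opp).
by rewrite pi_add.
Qed.

Fact presented_pi_monoid_morphism : monoid_morphism presented_pi.
Proof. by split; [exact: esym pi_one | move=> a b; exact: esym (pi_mul a b)]. Qed.

Fact presented_pi_scalable : scalable presented_pi.
Proof. by move=> c a; symmetry; exact: pi_scale. Qed.

HB.instance Definition _ := GRing.isZmodMorphism.Build free_alg presented
  presented_pi presented_pi_zmod_morphism.
HB.instance Definition _ := GRing.isMonoidMorphism.Build free_alg presented
  presented_pi presented_pi_monoid_morphism.
HB.instance Definition _ := GRing.isScalable.Build F free_alg presented *:%R
  presented_pi presented_pi_scalable.

(* algType excludes the zero ring, so presented is only given its pzRingType *)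
(* and lmodType structures; the next two lemmas say that they are compatible. *)
Lemma presented_scalerAl (c : F) (u v : presented) :
  c *: (u * v) = (c *: u) * v.
Proof.
case: (pi_surj u) (pi_surj v) => a -> [b ->].
rewrite -[pi a]/(presented_pi a) -[pi b]/(presented_pi b).
by rewrite -rmorphM -!linearZ -rmorphM scalerAl.
Qed.

Lemma presented_scalerAr (c : F) (u v : presented) :
  c *: (u * v) = u * (c *: v).
Proof.
case: (pi_surj u) (pi_surj v) => a -> [b ->].
rewrite -[pi a]/(presented_pi a) -[pi b]/(presented_pi b).
by rewrite -rmorphM -!linearZ -rmorphM scalerAr.
Qed.

Lemma presented_rel a b : rel a b -> presented_pi a = presented_pi b.
Proof.
by move=> Rab; apply/eqP/presented_eqP; apply: IdealGen; exists a, b.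
Qed.

End Presentation.

Local Notation "p %:F" := (@FracField.tofrac _ p).

Section Polynomials.

Variable F : fieldType.

(* The polynomial equal to the rational function z; 0 if z is not one. *)
Definition poly_of_frac n (z : {fraction {mpoly F[n]}}) : {mpoly F[n]} :=
  if pselect (exists p : {mpoly F[n]}, p%:F == z) is left h then xchoose h
  else 0.

Lemma poly_of_fracK n (p : {mpoly F[n]}) : poly_of_frac p%:F = p.
Proof.
rewrite /poly_of_frac; case: pselect => [h|[]]; last by exists p.
by apply/eqP; rewrite -tofrac_eq; exact: (xchooseP h).
Qed.

(* The monomial u^p v^q. *)
Definition mon2 (p q : nat) : 'X_{1..2} :=
  [multinom nth 0%N [:: p; q] k | k < 2].

Definition subst2 n (p : {mpoly F[2]}) (a b : {mpoly F[n]}) : {mpoly F[n]} :=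
  p \mPo [tuple a; b].

Definition subst3 n (p : {mpoly F[3]}) (a b c : {mpoly F[n]}) : {mpoly F[n]} :=
  p \mPo [tuple a; b; c].

Definition Xu : {mpoly F[3]} := 'X_(@Ordinal 3 0 isT).
Definition Xv : {mpoly F[3]} := 'X_(@Ordinal 3 1 isT).
Definition Xw : {mpoly F[3]} := 'X_(@Ordinal 3 2 isT).

Definition Qbar (Q : {mpoly F[2]}) : {mpoly F[3]} :=
  poly_of_frac
    (((subst2 Q Xu Xv)%:F - (subst2 Q Xw Xv)%:F) / (Xu%:F - Xw%:F)).

Definition Pbar1 (P : {mpoly F[2]}) : {mpoly F[3]} :=
  let p a b := (subst2 P a b)%:F in
  let u := Xu%:F in let v := Xv%:F in let w := Xw%:F in
  poly_of_frac
    (p Xv Xu * p Xu Xw / ((u - v) * (u - w))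
     + p Xu Xw * p Xv Xw / ((u - w) * (v - w))
     - p Xu Xv * p Xv Xw / ((u - v) * (v - w))).

Definition Pbar2 (P : {mpoly F[2]}) : {mpoly F[3]} :=
  let p a b := (subst2 P a b)%:F in
  let u := Xu%:F in let v := Xv%:F in let w := Xw%:F in
  poly_of_frac
    (- (p Xu Xv * p Xu Xw / ((u - v) * (u - w)))
     - p Xu Xw * p Xw Xv / ((u - w) * (v - w))
     + p Xu Xv * p Xv Xw / ((u - v) * (v - w))).

End Polynomials.

(* Place permutations.  Indices are shifted by one: t : 'I_d.-1 stands for *)
(* t + 1 in {1, ..., d - 1}, and pos t, posS t : 'I_d for the places t + 1 *)
(* and t + 2. *)

Section Places.

Variable d : nat.

Definition pos (t : 'I_d.-1) : 'I_d := widen_ord (leq_pred d) t.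

Fact posS_subproof (t : 'I_d.-1) : (t.+1 < d)%N.
Proof. by case: d t => [|n] [t ht] //=. Qed.

Definition posS (t : 'I_d.-1) : 'I_d := Ordinal (posS_subproof t).

Definition simple_refl (t : 'I_d.-1) : 'S_d := tperm (pos t) (posS t).

Definition expr_prod (e : seq 'I_d.-1) : 'S_d :=
  (\prod_(t <- e) simple_refl t)%g.

Definition reduced_expr (w : 'S_d) (e : seq 'I_d.-1) : Prop :=
  expr_prod e = w /\ forall e', expr_prod e' = w -> (size e <= size e')%N.

Definition refl_poly (F : fieldType) (t : 'I_d.-1) (f : {mpoly F[d]}) :=
  msym (simple_refl t) f.

Definition demazure (F : fieldType) (t : 'I_d.-1) (f : {mpoly F[d]}) :
    {mpoly F[d]} :=
  poly_of_frac
    (((refl_poly t f)%:F - f%:F) / (('X_(pos t))%:F - ('X_(posS t))%:F)).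

End Places.

(* Q^+ is the free commutative monoid on the simple roots, so its elements *)
(* are the finite multisets on I; alpha i is the coefficient of alpha_i. *)

Section Sequences.

Variable I : countType.

Definition weight (s : seq I) : {mset I} :=
  (\big[msetD/mset0]_(i <- s) [mset i])%mset.

Definition height (alpha : {mset I}) : nat :=
  (\sum_(i <- finsupp alpha) alpha i)%N.

Lemma weightE (s : seq I) a : weight s a = count_mem a s.
Proof.
rewrite /weight; elim: s => [|x s IHs]; first by rewrite big_nil mset0E.
by rewrite big_cons msetE2 msetnE IHs /= eq_sym; case: eqP.
Qed.

Lemma weight_perm (s s' : seq I) : perm_eq s s' -> weight s = weight s'.
Proof.
by move=> /seq.permP E; apply/msetP => a; rewrite !weightE; exact: E.
Qed.

Record Seq (alpha : {mset I}) := MkSeq {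
  Seq_tuple :> (height alpha).-tuple I;
  Seq_weight : weight Seq_tuple == alpha
}.

Section SeqTheory.

Variable alpha : {mset I}.
Local Notation d := (height alpha).

HB.instance Definition _ := [isSub for @Seq_tuple alpha].
HB.instance Definition _ := [Countable of Seq alpha by <:].

Definition Seq_enum : seq (Seq alpha) :=
  undup (pmap insub (pmap insub (permutations (enum_mset alpha)))).

Fact Seq_enumP : Finite.axiom Seq_enum.
Proof.
apply: Finite.uniq_enumP => [|i]; first exact: undup_uniq.
rewrite inE mem_undup mem_pmap_sub mem_pmap_sub mem_permutations.
apply/allP => a _ /=; rewrite count_mem_mset -weightE.
by rewrite (eqP (Seq_weight i)).
Qed.

HB.instance Definition _ := isFinite.Build (Seq alpha) Seq_enumP.

Fact Seq_act_subproof (w : 'S_d) (i : Seq alpha) :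
  weight [tuple tnth i (w k) | k < d] == alpha.
Proof.
rewrite -[X in _ == X](eqP (Seq_weight i)); apply/eqP/weight_perm.
by apply/tuple_permP; exists w.
Qed.

(* A left action for the product of 'S_d, (s * w) k = w (s k), under which *)
(* simple_refl t swaps the entries at places pos t and posS t. *)
Definition Seq_act (w : 'S_d) (i : Seq alpha) : Seq alpha :=
  MkSeq (Seq_act_subproof w i).

Lemma Seq_actM (v w : 'S_d) i : Seq_act (v * w)%g i = Seq_act v (Seq_act w i).
Proof.
by apply/val_inj/eq_from_tnth => k; rewrite /= !tnth_mktuple permM.
Qed.

End SeqTheory.

End Sequences.

(* cartan is (a_ij), cartan_sym is (s_i), root_form is (alpha_i | alpha_j). *)
Record cartan_datum (I : countType) := CartanDatum {
  cartan : I -> I -> int;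
  cartan_sym : I -> nat;
  cartan_diag : forall i,
    cartan i i = 2 \/ (cartan i i <= 0 /\ (2 %| cartan i i)%Z);
  cartan_le0 : forall i j, i != j -> cartan i j <= 0;
  cartan_eq0 : forall i j, cartan i j = 0 <-> cartan j i = 0;
  cartan_sym_gt0 : forall i, (0 < cartan_sym i)%N;
  cartan_symE : forall i j,
    (cartan_sym i)%:Z * cartan i j = (cartan_sym j)%:Z * cartan j i
}.

Definition root_form (I : countType) (D : cartan_datum I) (i j : I) : int :=
  (cartan_sym D i)%:Z * cartan D i j.

(* 1 - a_ii / 2, a nonnegative integer. *)
Definition Pdeg (I : countType) (D : cartan_datum I) (i : I) : nat :=
  `|1 - (cartan D i i %/ 2)%Z|%N.

Record klr_datum (F : fieldType) (I : countType) (D : cartan_datum I) :=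
KLRDatum {
  Qpoly : I -> I -> {mpoly F[2]};
  Ppoly : I -> {mpoly F[2]};
  Qpoly_sym : forall i j, Qpoly i j = subst2 (Qpoly j i) 'X_ord_max 'X_ord0;
  Qpoly_diag : forall i, Qpoly i i = 0;
  Qpoly_supp : forall i j p q, i != j -> (Qpoly i j)@_(mon2 p q) != 0 ->
    root_form D i j + (cartan_sym D i * p)%N%:Z + (cartan_sym D j * q)%N%:Z
      = 0;
  Qpoly_lead : forall i j, i != j ->
    (Qpoly i j)@_(mon2 `|cartan D i j|%N 0) != 0;
  Ppoly_supp : forall i p q,
    (Ppoly i)@_(mon2 p q) != 0 -> (p + q)%N = Pdeg D i;
  Ppoly_leadl : forall i, (Ppoly i)@_(mon2 (Pdeg D i) 0) != 0;
  Ppoly_leadr : forall i, (Ppoly i)@_(mon2 0 (Pdeg D i)) != 0;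
  Ppoly_real : forall i, cartan D i i = 2 -> Ppoly i = 1
}.

Section KLR.

Variables (F : fieldType) (I : countType) (D : cartan_datum I).
Variables (K : klr_datum F D) (alpha : {mset I}).

Local Notation d := (height alpha).
Local Notation Q := (Qpoly K).
Local Notation P := (Ppoly K).
Local Notation refl t := (simple_refl t).

Definition klr_gen : Type := (Seq alpha + ('I_d + 'I_d.-1))%type.
HB.instance Definition _ := Choice.on klr_gen.

Local Notation FA := (free_alg F klr_gen).

Definition gen_e (i : Seq alpha) : FA := free_gen F (inl i : klr_gen).
Definition gen_x (k : 'I_d) : FA := free_gen F (inr (inl k) : klr_gen).
Definition gen_tau (t : 'I_d.-1) : FA := free_gen F (inr (inr t) : klr_gen).

(* f(x_1, ..., x_d); each monomial is expanded as x_1^m_1 ... x_d^m_d. *)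
Definition gen_poly (f : {mpoly F[d]}) : FA :=
  mmap (fun c => c%:A : FA) gen_x f.

(* In klr_braid, a, b, c are the places t, t + 1, t + 2. *)
Inductive klr_rel : FA -> FA -> Prop :=
| klr_idem i j :
    klr_rel (gen_e i * gen_e j) (if i == j then gen_e i else 0)
| klr_unit :
    klr_rel (\sum_i gen_e i) 1
| klr_xe k i :
    klr_rel (gen_x k * gen_e i) (gen_e i * gen_x k)
| klr_xx k l :
    klr_rel (gen_x k * gen_x l) (gen_x l * gen_x k)
| klr_taue t i :
    klr_rel (gen_tau t * gen_e i) (gen_e (Seq_act (refl t) i) * gen_tau t)
| klr_tautau (s t : 'I_d.-1) of (s.+1 < t)%N || (t.+1 < s)%N :
    klr_rel (gen_tau t * gen_tau s) (gen_tau s * gen_tau t)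
| klr_tau2 t (i : Seq alpha) :
    let it := tnth i (pos t) in let it1 := tnth i (posS t) in
    klr_rel (gen_tau t ^+ 2 * gen_e i)
      (if it == it1
       then gen_poly (demazure t (subst2 (P it) 'X_(pos t) 'X_(posS t)))
              * gen_tau t * gen_e i
       else gen_poly (subst2 (Q it it1) 'X_(pos t) 'X_(posS t)) * gen_e i)
| klr_taux t k (i : Seq alpha) :
    let it := tnth i (pos t) in let it1 := tnth i (posS t) in
    let Pt := gen_poly (subst2 (P it) 'X_(pos t) 'X_(posS t)) in
    klr_rel ((gen_tau t * gen_x k - gen_x (refl t k) * gen_tau t) * gen_e i)
      (if (k == pos t) && (it == it1) then - Pt * gen_e i
       else if (k == posS t) && (it == it1) then Pt * gen_e i
       else 0)
| klr_braid (t t1 : 'I_d.-1) (i : Seq alpha) of t1 = t.+1 :> nat :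
    let a := pos t in let b := posS t in let c := posS t1 in
    let ia := tnth i a in let ib := tnth i b in let ic := tnth i c in
    klr_rel
      ((gen_tau t1 * gen_tau t * gen_tau t1 - gen_tau t * gen_tau t1 * gen_tau t)
         * gen_e i)
      (if (ia == ic) && (ia != ib)
       then gen_poly (subst2 (P ia) 'X_a 'X_c
                      * subst3 (Qbar (Q ia ib)) 'X_a 'X_b 'X_c) * gen_e i
       else if (ia == ib) && (ib == ic)
       then gen_poly (subst3 (Pbar1 (P ia)) 'X_a 'X_b 'X_c)
              * gen_tau t * gen_e i
            + gen_poly (subst3 (Pbar2 (P ia)) 'X_a 'X_b 'X_c)
              * gen_tau t1 * gen_e i
       else 0).

Definition klr : Type := presented klr_rel.

HB.instance Definition _ := Choice.on klr.
HB.instance Definition _ := GRing.PzRing.on klr.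
HB.instance Definition _ := GRing.Lmodule.on klr.

Definition klr_pi : FA -> klr := @presented_pi F klr_gen klr_rel.

Definition klr_e (i : Seq alpha) : klr := klr_pi (gen_e i).
Definition klr_x (k : 'I_d) : klr := klr_pi (gen_x k).
Definition klr_tau (t : 'I_d.-1) : klr := klr_pi (gen_tau t).

Definition klr_tau_word (e : seq 'I_d.-1) : klr := \prod_(t <- e) klr_tau t.
Definition klr_x_mon (m : 'X_{1..d}) : klr := \prod_(k < d) klr_x k ^+ m k.

(* klr_deg n a : a lies in the component R(alpha)_n of the grading, the span *)
(* of the products of total degree n of the 1_i, x_k 1_i and tau_t 1_i. *)
Inductive klr_deg : int -> klr -> Prop :=
| klr_deg_e i : klr_deg 0 (klr_e i)
| klr_deg_x k (i : Seq alpha) :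
    klr_deg (2 * (cartan_sym D (tnth i k))%:Z) (klr_x k * klr_e i)
| klr_deg_tau t (i : Seq alpha) :
    klr_deg (- root_form D (tnth i (pos t)) (tnth i (posS t)))
      (klr_tau t * klr_e i)
| klr_deg_mul m n a b of klr_deg m a & klr_deg n b : klr_deg (m + n) (a * b)
| klr_deg_zero n : klr_deg n 0
| klr_deg_add n a b of klr_deg n a & klr_deg n b : klr_deg n (a + b)
| klr_deg_scale n c a of klr_deg n a : klr_deg n (c *: a).

Definition klr_homogeneous (a : klr) : Prop := exists n, klr_deg n a.

Definition klr_corner (j i : Seq alpha) (a : klr) : Prop :=
  exists b, a = klr_e j * b * klr_e i.

(* Pol(alpha); pol_in i f is f(i), so the value at i of v : Pol is the *)
(* component of v in F[x_1(i), ..., x_d(i)]. *)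
Definition Pol : Type := {ffun Seq alpha -> {mpoly F[d]}}.
HB.instance Definition _ := GRing.Lmodule.on Pol.

Definition pol_in (i : Seq alpha) (f : {mpoly F[d]}) : Pol :=
  [ffun j => if j == i then f else 0].

Definition pol_tau (prec : rel I) (t : 'I_d.-1) (i : Seq alpha)
    (f : {mpoly F[d]}) : Pol :=
  let it := tnth i (pos t) in let it1 := tnth i (posS t) in
  pol_in (Seq_act (refl t) i)
    (if it == it1 then subst2 (P it) 'X_(pos t) 'X_(posS t) * demazure t f
     else if prec it1 it
     then subst2 (Q it1 it) 'X_(pos t) 'X_(posS t) * refl_poly t f
     else refl_poly t f).

Definition pol_action (prec : rel I) (rho : klr -> Pol -> Pol) : Prop :=
  [/\ forall j i f, rho (klr_e j) (pol_in i f) = if i == j then pol_in i f else 0,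
      forall k i f, rho (klr_x k) (pol_in i f) = pol_in i ('X_k * f)
    & forall t i f, rho (klr_tau t) (pol_in i f) = pol_tau prec t i f].

Definition is_representation (V : lmodType F) (rho : klr -> V -> V) : Prop :=
  [/\ forall a, linear (rho a),
      forall v, linear (rho^~ v),
      forall v, rho 1 v = v
    & forall a b v, rho (a * b) v = rho a (rho b v)].

Definition faithful_rep (V : lmodType F) (rho : klr -> V -> V) : Prop :=
  forall a, (forall v, rho a v = 0) -> a = 0.

End KLR.

Arguments klr_corner {F I D} K {alpha} j i a.

(* (b k) for k in B is a linearly independent family spanning U. *)
Definition is_basis (F : fieldType) (V : lmodType F) (U : V -> Prop)
    (J : eqType) (B : pred J) (b : J -> V) : Prop :=
  [/\ forall k, B k -> U (b k),
      forall (s : seq J) (c : J -> F), uniq s -> all B s ->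
        \sum_(k <- s) c k *: b k = 0 -> {in s, forall k, c k = 0}
    & forall v, U v ->
        exists (s : seq J) (c : J -> F),
          all B s /\ v = \sum_(k <- s) c k *: b k].

Definition strict_total_order (T : eqType) (lt : rel T) : Prop :=
  [/\ irreflexive lt, transitive lt
    & forall x y, x != y -> lt x y || lt y x].

(* Main.v *)
(* Spanning: up to words with fewer letters, the products of the tau_t satisfy *)
(* the braid relations, x's move to the right, and tau_t^2 is shorter; by *)
(* Matsumoto's theorem for the symmetric group every word therefore reduces to *)
(* the chosen words red w.  Matsumoto's theorem is obtained by rewriting any *)
(* word, using braid and commutation moves only, either into a product of *)
(* descending runs, which is determined by its permutation, or into a word with *)
(* a repeated letter.                                                         *)
(*   Independence: on Pol(alpha), tau_{red w} f is, after clearing denominators, *)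
(* a combination of the v(f) with v strictly shorter than w, plus a nonzero    *)
(* multiple of w(f).  The automorphisms v are linearly independent over        *)
(* polynomials (Dedekind), so in a combination killed by the representation    *)
(* the coefficients vanish one length after the other, longest first.  This    *)
(* gives faithfulness as well.                                                *)

(* Spanning is an induction over the filtration [short l], the span of the elements [word_elt a m i]
   with fewer than [l] tau letters. Every correction term in a defining relation has fewer tau
   letters, and an x moves to the right without adding any ([short_x]). Modulo shorter elements, tau
   words may therefore be changed by braid moves ([word_elt_braid]), and a word that braid moves
   bring to a repeated letter vanishes ([word_elt_square]). By [braid_eq_reduced] every word either
   is braid equivalent to the chosen reduced word of its permutation or leads to such a repetition,
   whence [klr_reduced_span].

   The polynomial representation is checked with denominators cleared: each operator satisfies
   [del * tau f = A * r f + B * f] with [del] a difference of two variables ([tau_opE]). Each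
   relation becomes an identity between combinations of permuted copies of [f], and the nonzero
   factors can be cancelled. The hard case is [tau_op_braid]. The action descends to the presented
   algebra by [presented_actE].

   Independence and faithfulness both follow from [red_elt_independent]: a combination of the
   [red_elt i k] that kills the component of Pol at [i] has zero coefficients. Its ingredients are
   the triangular expansion of a tau word in the permutation automorphisms ([word_at_expansion]),
   Dedekind's theorem ([msym_independent]) and the independence of monomials. For faithfulness,
   write [a] as the sum of the [a * klr_e K i]; each is such a combination by spanning. *)
From HB Require Import structures.
Require Import Defs.
From mathcomp Require Import all_boot all_order all_algebra all_fingroup.
From mathcomp Require Import generic_quotient fraction boolp.
From mathcomp Require Import finmap multiset.
From mathcomp Require Import ring zify.
From mathcomp.multinomials Require Import (canonicals, coercions) monalg.
From mathcomp.multinomials Require Import mpoly.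

Set Implicit Arguments.
Unset Strict Implicit.
Unset Printing Implicit Defensive.

Import GRing.Theory.
Local Open Scope mset_scope.
Local Open Scope ring_scope.

(** * Words in the simple reflections *)

Section Words.

Variable d : nat.
Implicit Types (s t x y : 'I_d.-1) (a b e r : seq 'I_d.-1).

Inductive braid_eq : seq 'I_d.-1 -> seq 'I_d.-1 -> Prop :=
| BraidRefl e : braid_eq e e
| BraidSym e e' of braid_eq e e' : braid_eq e' e
| BraidTrans e e' e'' of braid_eq e e' & braid_eq e' e'' : braid_eq e e''
| BraidComm a b s t of (s.+1 < t)%N || (t.+1 < s)%N :
    braid_eq (a ++ [:: s, t & b]) (a ++ [:: t, s & b])
| BraidBraid a b s t of t = s.+1 :> nat :
    braid_eq (a ++ [:: s, t, s & b]) (a ++ [:: t, s, t & b]).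

Lemma braid_eq_cat a b e e' : braid_eq e e' -> braid_eq (a ++ e ++ b) (a ++ e' ++ b).
Proof.
elim=> {e e'} [e|e e' _|e e' e'' _ IH1 _|a' b' s t st|a' b' s t st].
- exact: BraidRefl.
- exact: BraidSym.
- exact: BraidTrans.
- by rewrite -!catA /= !(catA a a'); exact: BraidComm.
- by rewrite -!catA /= !(catA a a'); exact: BraidBraid.
Qed.

Lemma braid_eq_catl a e e' : braid_eq e e' -> braid_eq (a ++ e) (a ++ e').
Proof. by move=> /(braid_eq_cat a [::]); rewrite !cats0. Qed.

Lemma braid_eq_catr b e e' : braid_eq e e' -> braid_eq (e ++ b) (e' ++ b).
Proof. exact: (braid_eq_cat [::]). Qed.

Lemma braid_eq_size e e' : braid_eq e e' -> size e = size e'.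
Proof.
by elim=> {e e'} //= [e e' e'' _ -> //|a b s t _|a b s t _]; rewrite !size_cat.
Qed.

Lemma expr_prod_cat a b : expr_prod (a ++ b) = (expr_prod a * expr_prod b)%g.
Proof. exact: big_cat. Qed.

Lemma expr_prod_cons t e : expr_prod (t :: e) = (simple_refl t * expr_prod e)%g.
Proof. exact: big_cons. Qed.

Lemma simple_reflK t : (simple_refl t * simple_refl t = 1)%g.
Proof. exact: tperm2. Qed.

Lemma simple_reflC s t : (s.+1 < t)%N || (t.+1 < s)%N ->
  (simple_refl s * simple_refl t = simple_refl t * simple_refl s)%g.
Proof.
move=> st; apply/commgP/conjg_fixP; rewrite /simple_refl tpermJ.
by rewrite !tpermD //; apply/eqP => /(congr1 val) /=; lia.
Qed.

Lemma simple_refl_braid s t : t = s.+1 :> nat ->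
  (simple_refl s * simple_refl t * simple_refl s
   = simple_refl t * simple_refl s * simple_refl t)%g.
Proof.
move=> ts; have conjE x y : (simple_refl x * simple_refl y * simple_refl x
    = simple_refl y ^ simple_refl x)%g.
  by rewrite conjgE /simple_refl tpermV mulgA.
have E : posS s = pos t by apply/val_inj.
rewrite !conjE /simple_refl !tpermJ E !tpermR !tpermL.
by rewrite !tpermD //; apply/eqP => /(congr1 val) /=; lia.
Qed.

Lemma braid_eq_prod e e' : braid_eq e e' -> expr_prod e = expr_prod e'.
Proof.
elim=> {e e'} // [e e' e'' _ -> //|a b s t st|a b s t st].
- by rewrite !expr_prod_cat !expr_prod_cons; congr (_ * _)%g;
    rewrite !mulgA (simple_reflC st).
- by rewrite !expr_prod_cat !expr_prod_cons; congr (_ * _)%g;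
    rewrite !mulgA (simple_refl_braid st).
Qed.

(** A certificate at the level of words that [e] is not reduced ([has_square_nonreduced]). In the
    KLR algebra it marks the place where the quadratic relation shortens the word. *)
Definition has_square e :=
  exists a s b, braid_eq e (a ++ [:: s, s & b]).

Lemma has_square_cat a b e : has_square e -> has_square (a ++ e ++ b).
Proof.
move=> [a' [s [b' E]]]; exists (a ++ a'), s, (b' ++ b).
by have := braid_eq_cat a b E; rewrite -!catA.
Qed.

Lemma has_square_eq e e' : braid_eq e e' -> has_square e' -> has_square e.
Proof. by move=> E [a [s [b E']]]; exists a, s, b; apply: BraidTrans E'. Qed.

Lemma has_square_nonreduced w e : reduced_expr w e -> ~ has_square e.
Proof.
move=> [Ew min_e] [a [s [b E]]].
have := min_e (a ++ b); rewrite -Ew (braid_eq_prod E) (braid_eq_size E).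
rewrite !expr_prod_cat !expr_prod_cons [(simple_refl s * _)%g]mulgA simple_reflK mul1g.
by move=> /(_ erefl); rewrite !size_cat /=; lia.
Qed.

(* [drun n r]: r is n-1, n-2, n-3, ... up to some length. *)
Fixpoint drun n r :=
  if r is t :: r' then (t.+1 == n) && drun t r' else true.

Lemma drun_ltn n r : drun n r -> all (fun t : 'I_d.-1 => (t < n)%N) r.
Proof.
elim: r n => //= t r IH n /andP[/eqP <- /IH /allP rt]; rewrite ltnS leqnn.
by apply/allP => x /rt; exact: leqW.
Qed.

Lemma drun_size n r : drun n r -> (size r <= n)%N.
Proof. by elim: r n => //= t r IH n /andP[/eqP <- /IH]. Qed.

Lemma drun_inj n r r' : drun n r -> drun n r' -> size r = size r' -> r = r'.
Proof.
elim: r n r' => [|t r IH] n [|t' r'] //= /andP[/eqP tn tr] /andP[/eqP tn' tr'] [sz].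
have E : t = t' by apply/val_inj/eq_add_S; rewrite tn tn'.
by rewrite -E in tr' *; rewrite (IH _ _ tr tr' sz).
Qed.

Lemma braid_eq_rcons t r : all (fun x : 'I_d.-1 => x.+1 < t)%N r ->
  braid_eq (rcons r t) (t :: r).
Proof.
elim: r => [|x r IH] /=; first by move=> _; exact: BraidRefl.
move=> /andP[xt /IH E]; apply: (@BraidTrans _ (x :: t :: r)).
  exact: (braid_eq_catl [:: x] E).
by apply: (BraidComm [::] r); rewrite xt.
Qed.

(* The braid move [x x-1 x -> x-1 x x-1] carries a letter [x] of a descending *)
(* run through the run, where it comes out as [x-1]. *)
Lemma drun_rcons n r t : drun n r -> (t < n)%N ->
  [\/ drun n (rcons r t), has_square (rcons r t)
    | exists2 t' : 'I_d.-1, (t'.+1 < n)%N & braid_eq (rcons r t) (t' :: r)].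
Proof.
elim: r n => [|x r IH] n /=.
  rewrite leq_eqVlt => _ /orP[tn|tn]; first by constructor 1; rewrite tn.
  by constructor 3; exists t => //; exact: BraidRefl.
move=> /andP[/eqP <- xr]; rewrite ltnS leq_eqVlt => /orP[/eqP/val_inj ->|tx].
  case: r xr {IH} => [|y r] /=.
    by constructor 2; exists [::], x, [::]; exact: BraidRefl.
  move=> /andP[/eqP yx yr]; constructor 3; exists y; first by rewrite -yx.
  apply: (@BraidTrans _ [:: x, y, x & r]).
    apply: (braid_eq_catl [:: x; y]); apply: braid_eq_rcons.
    by rewrite -yx; exact: drun_ltn.
  by apply: BraidSym; apply: (BraidBraid [::] r); rewrite yx.
case: (IH _ xr tx) => [rt|[a [s [b E]]]|[t' t'x E]].
- by constructor 1; rewrite eqxx.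
- constructor 2; exists (x :: a), s, b; exact: (braid_eq_catl [:: x] E).
- constructor 3; exists t'; first exact: leqW.
  apply: BraidTrans (braid_eq_catl [:: x] E) _.
  by apply: (BraidComm [::] r); rewrite t'x orbT.
Qed.

(** The coset normal form of the symmetric group. The last run, empty or starting with the letter
    [n], represents a coset of the subgroup generated by the smaller letters. *)
Inductive normal : nat -> seq 'I_d.-1 -> Prop :=
| Normal0 : normal 0 [::]
| NormalS n e r of normal n e & drun n.+1 r : normal n.+1 (e ++ r).

Lemma normal_nil n : normal n [::].
Proof.
by elim: n => [|n IH]; [exact: Normal0 | exact: (@NormalS n [::] [::])].
Qed.

Definition reduces n e := (exists2 e', normal n e' & braid_eq e e') \/ has_square e.

(** The new letter lengthens the last run, or creates a square, or crosses that run and comes out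
    small enough for the induction on the preceding runs. *)
Lemma normal_rcons n e t : normal n e -> (t < n)%N -> reduces n (rcons e t).
Proof.
move=> nf_e; elim: nf_e t => {n e} // n e r nf_e IH r_run t tn.
rewrite -cats1 -catA cats1; case: (drun_rcons r_run tn) => [rt|sq|[t' t'n E]].
- by left; exists (e ++ rcons r t); [exact: NormalS | exact: BraidRefl].
- by right; have := has_square_cat e [::] sq; rewrite cats0.
have E' := braid_eq_catl e E; rewrite -cat_rcons in E'.
case: (IH t' t'n) => [[e' nf_e' Ee']|sq].
  left; exists (e' ++ r); first exact: NormalS.
  exact: BraidTrans E' (braid_eq_catr r Ee').
by right; apply: has_square_eq E' (has_square_cat [::] r sq).
Qed.

Lemma reducesP e : reduces d.-1 e.
Proof.
elim/last_ind: e => [|e t [[e' nf_e' E]|sq]].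
- by left; exists [::]; [exact: normal_nil | exact: BraidRefl].
- have E' : braid_eq (rcons e t) (rcons e' t).
    by rewrite -!cats1; exact: braid_eq_catr.
  case: (normal_rcons nf_e' (ltn_ord t)) => [[e'' nf_e'' E'']|sq].
    by left; exists e'' => //; exact: BraidTrans E' E''.
  by right; exact: has_square_eq E' sq.
- by right; rewrite -cats1; exact: (has_square_cat [::] [:: t]).
Qed.

Lemma normal_ltn n e : normal n e -> all (fun t : 'I_d.-1 => (t < n)%N) e.
Proof.
elim=> {n e} // n e r _ /allP IH /drun_ltn; rewrite all_cat => ->.
by rewrite andbT; apply/allP => t /IH; exact: leqW.
Qed.

Lemma expr_prod_fix e (p : 'I_d) :
  all (fun t : 'I_d.-1 => t.+1 < p)%N e -> expr_prod e p = p.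
Proof.
elim: e => [|t e IH] /=; first by rewrite /expr_prod big_nil perm1.
move=> /andP[tp /IH E]; rewrite expr_prod_cons permM /simple_refl tpermD ?E //;
  by apply/eqP => /(congr1 val) /=; lia.
Qed.

Lemma expr_prod_drun n r (p : 'I_d) : drun n r -> p = n :> nat ->
  expr_prod r p = (n - size r)%N :> nat.
Proof.
elim: r n p => [|t r IH] n p /=; first by rewrite /expr_prod big_nil perm1 subn0.
move=> /andP[/eqP tn tr] pn; have -> : p = posS t by apply/val_inj; rewrite /= tn.
by rewrite expr_prod_cons permM /simple_refl tpermR (IH _ _ tr) // -tn subSS.
Qed.

(** The letters of [e] fix the place of index [n.+1], so the image of this place under the whole
    product measures the last run. That run is then cancelled. *)
Lemma normal_inj n e e' :
  normal n e -> normal n e' -> expr_prod e = expr_prod e' -> e = e'.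
Proof.
move=> nf_e; elim: nf_e e' => {n e} [|n e r nf_e IH run_r] e' nf_e'.
  by inversion nf_e'.
inversion nf_e' as [|n' e1 r' nf_e1 run_r' En Ee'] => {nf_e' Ee' e'}.
rewrite !expr_prod_cat => Eprod.
(* The place to be tracked exists only if [n] is a letter; otherwise both runs are empty. *)
have Esize (x : 'I_d.-1) : x = n :> nat -> size r = size r'.
  move=> xn; have fixp u : normal n u -> expr_prod u (posS x) = posS x.
    by move=> /normal_ltn nf_u; apply: expr_prod_fix; rewrite /= xn.
  have := congr1 (fun w : 'S_d => w (posS x) : nat) Eprod.
  rewrite /= !permM (fixp e) // (fixp e1) //.
  have pE : posS x = n.+1 :> nat by rewrite /= xn.
  rewrite (expr_prod_drun run_r pE) (expr_prod_drun run_r' pE).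
  by have := drun_size run_r; have := drun_size run_r'; lia.
have Er : r = r'.
  apply: (drun_inj run_r run_r').
  case: (r) (run_r) Esize => [_|x r0 /andP[/eqP[xn] _] /(_ x xn) //].
  by case: (r') run_r' => [|y r1 /andP[/eqP[yn] _] /(_ y yn)].
by rewrite -Er in Eprod *; rewrite (IH e1) //; exact: mulIg Eprod.
Qed.

(* Matsumoto's theorem, with Tits' solution of the word problem. *)
Lemma braid_eq_reduced e e' : reduced_expr (expr_prod e) e' ->
  braid_eq e e' \/ has_square e.
Proof.
move=> red_e'; case: (reducesP e) => [[u nf_u Eu]|]; last by right.
case: (reducesP e') => [[u' nf_u' Eu']|/(has_square_nonreduced red_e')//].
left; suff Euu' : u = u' by apply: BraidTrans Eu _; rewrite Euu'; exact: BraidSym.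
apply: normal_inj nf_u nf_u' _.
by rewrite -(braid_eq_prod Eu) -(braid_eq_prod Eu'); case: red_e'.
Qed.

End Words.

(** * Divided differences *)

Section Polys.

Variable F : fieldType.

Lemma mpolyX_neq n (i j : 'I_n) : i != j -> 'X_i - 'X_j != 0 :> {mpoly F[n]}.
Proof.
move=> ij; rewrite subr_eq0; apply: contra ij => /eqP E.
have := congr1 (mcoeff U_(i)) E; rewrite !mcoeffX eqxx eq_mnm1 [j == i]eq_sym.
by case: eqP => // _ /eqP; rewrite oner_eq0.
Qed.

Lemma rmorph_comp_mpoly n k m (phi : {rmorphism {mpoly F[k]} -> {mpoly F[m]}})
    (p : {mpoly F[n]}) (lp : n.-tuple {mpoly F[k]}) :
  (forall c, phi c%:MP = c%:MP) ->
  phi (p \mPo lp) = p \mPo [tuple phi (tnth lp i) | i < n].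
Proof.
move=> phiC; rewrite !comp_mpolyE rmorph_sum; apply: eq_bigr => mu _ /=.
rewrite -!mul_mpolyC rmorphM phiC rmorph_prod; congr (_ * _).
by apply: eq_bigr => i _; rewrite rmorphXn tnth_mktuple.
Qed.

Lemma rmorph_subst2 k m (phi : {rmorphism {mpoly F[k]} -> {mpoly F[m]}})
    (p : {mpoly F[2]}) (a b : {mpoly F[k]}) :
  (forall c, phi c%:MP = c%:MP) ->
  phi (subst2 p a b) = subst2 p (phi a) (phi b).
Proof.
move=> phiC; rewrite /subst2 rmorph_comp_mpoly //; congr (p \mPo _).
by apply: eq_from_tnth => i; rewrite tnth_mktuple !(tnth_nth 0); case: i => [[|[|]]].
Qed.

Lemma msymC n (w : 'S_n) (c : F) : msym w c%:MP = c%:MP.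
Proof. exact: mmapC. Qed.

Lemma msymXU n (w : 'S_n) (i : 'I_n) : msym w 'X_i = 'X_(w i) :> {mpoly F[n]}.
Proof.
by rewrite msymX; congr 'X_[_]; apply/mnmP => j; rewrite !mnmE -(canF_eq (permK w)).
Qed.

Lemma msym_subst2 n (w : 'S_n) (p : {mpoly F[2]}) (a b : {mpoly F[n]}) :
  msym w (subst2 p a b) = subst2 p (msym w a) (msym w b).
Proof. exact/rmorph_subst2/msymC. Qed.

Lemma subst3XU n (a b c : {mpoly F[n]}) :
  ((subst3 (Xu F) a b c = a) * (subst3 (Xv F) a b c = b) * (subst3 (Xw F) a b c = c))%type.
Proof. by do 2?split; rewrite /subst3 comp_mpolyXU. Qed.

Lemma subst3_subst2 n (p : {mpoly F[2]}) (q r : {mpoly F[3]}) (a b c : {mpoly F[n]}) :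
  subst3 (subst2 p q r) a b c = subst2 p (subst3 q a b c) (subst3 r a b c).
Proof. by apply/rmorph_subst2 => x; exact: comp_mpolyC. Qed.

Lemma subst2_swap n (p : {mpoly F[2]}) (a b : {mpoly F[n]}) :
  subst2 (subst2 p 'X_ord_max 'X_ord0) a b = subst2 p b a.
Proof.
rewrite {1}/subst2 rmorph_subst2 => [|c]; last exact: comp_mpolyC.
by rewrite /= !comp_mpolyXU.
Qed.

Definition merge_tuple n (i j : 'I_n) : n.-tuple {mpoly F[n]} :=
  [tuple 'X_(if k == i then j else k) | k < n].

(** Restriction to the hyperplane ['X_i = 'X_j]; its vanishing is the test for divisibility by
    ['X_i - 'X_j]. *)
Definition merge_var n (i j : 'I_n) : {mpoly F[n]} -> {mpoly F[n]} :=
  comp_mpoly (merge_tuple i j).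

HB.instance Definition _ n (i j : 'I_n) :=
  GRing.RMorphism.copy (merge_var i j) (comp_mpoly (merge_tuple i j)).

Lemma merge_varC n (i j : 'I_n) c : merge_var i j c%:MP = c%:MP.
Proof. exact: comp_mpolyC. Qed.

Lemma merge_varX n (i j k : 'I_n) :
  merge_var i j 'X_k = 'X_(if k == i then j else k).
Proof. by rewrite /merge_var comp_mpolyXU -tnth_nth tnth_mktuple. Qed.

Lemma merge_varM n (i j : 'I_n) f g :
  merge_var i j (f * g) = merge_var i j f * merge_var i j g.
Proof. exact: rmorphM. Qed.

Lemma merge_varN n (i j : 'I_n) f : merge_var i j (- f) = - merge_var i j f.
Proof. exact: rmorphN. Qed.

(** The property is stable under sums and products and holds for constants and variables. *)
Lemma merge_var_sub n (i j : 'I_n) f :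
  exists q, f - merge_var i j f = ('X_i - 'X_j) * q.
Proof.
pose P f := exists q, f - merge_var i j f = ('X_i - 'X_j) * q.
have PD g h : P g -> P h -> P (g + h).
  move=> [q Eg] [r Eh]; exists (q + r); rewrite mulrDr -Eg -Eh rmorphD.
  by ring.
have PM g h : P g -> P h -> P (g * h).
  move=> [q Eg] [r Eh]; exists (q * h + merge_var i j g * r).
  rewrite mulrDr mulrA -Eg [_ * (_ * r)]mulrCA -Eh rmorphM; ring.
have PC c : P c%:MP by exists 0; rewrite merge_varC subrr mulr0.
have PX k : P 'X_k.
  rewrite /P merge_varX; case: eqP => [->|_]; first by exists 1; rewrite mulr1.
  by exists 0; rewrite subrr mulr0.
rewrite -/(P f); elim/mpolyind: f => [|c m p _ _ IH]; first exact: (PC 0).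
apply: (PD) IH; rewrite -mul_mpolyC; apply: (PM); first exact: PC.
rewrite mpolyXE_id; elim/big_ind: _ => [||k _]; [exact: (PC 1) | exact: PM |].
elim: (m k) => [|x IH]; first exact: (PC 1).
by rewrite exprS; apply: (PM).
Qed.

Lemma merge_var_div n (i j : 'I_n) f :
  merge_var i j f = 0 -> exists q, f = ('X_i - 'X_j) * q.
Proof. by move=> E; have [q] := merge_var_sub i j f; rewrite E subr0; exists q. Qed.

Lemma merge_var_eq n (i j : 'I_n) f g :
  merge_var i j f = merge_var i j g -> exists q, f - g = ('X_i - 'X_j) * q.
Proof. by move=> E; apply: merge_var_div; rewrite rmorphB /= E subrr. Qed.

Lemma merge_var_msym n (i j : 'I_n) f :
  merge_var i j (msym (tperm i j) f) = merge_var i j f.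
Proof.
rewrite /merge_var msym_mPo; congr (f \mPo _); apply: eq_from_tnth => k.
rewrite !tnth_mktuple; congr 'X_(_).
by case: tpermP => [->|->|/eqP/negPf ki /eqP/negPf kj]; rewrite ?eqxx ?ki //; case: eqP.
Qed.

Local Notation "p %:F" := (@FracField.tofrac _ p).

Lemma poly_of_frac_div n (p q r : {mpoly F[n]}) :
  q != 0 -> p = q * r -> poly_of_frac (p%:F / q%:F) = r.
Proof.
move=> q0 ->; rewrite rmorphM /= mulrAC divff ?tofrac_eq0 // mul1r.
exact: poly_of_fracK.
Qed.

Lemma pos_neq d (t : 'I_d.-1) : pos t != posS t.
Proof. by apply/eqP => /(congr1 val) /=; lia. Qed.

Definition root_diff d (t : 'I_d.-1) : {mpoly F[d]} := 'X_(pos t) - 'X_(posS t).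

Lemma root_diff_neq0 d (t : 'I_d.-1) : root_diff t != 0.
Proof. exact/mpolyX_neq/pos_neq. Qed.

(** A polynomial and its image under a transposition agree on the hyperplane of that transposition.
    Hence the quotient in [demazure] is a polynomial, and [poly_of_frac] does not fall back on its
    default value 0. *)
Lemma demazureE d (t : 'I_d.-1) (f : {mpoly F[d]}) :
  root_diff t * demazure t f = refl_poly t f - f.
Proof.
have [q Eq] := merge_var_eq (merge_var_msym (pos t) (posS t) f).
by rewrite /root_diff /demazure -!rmorphB /= (poly_of_frac_div (mpolyX_neq (pos_neq t)) Eq) -Eq.
Qed.

Lemma merge_var_subst2 n (i j : 'I_n) (p : {mpoly F[2]}) a b :
  merge_var i j (subst2 p a b) = subst2 p (merge_var i j a) (merge_var i j b).
Proof. exact/rmorph_subst2/merge_varC. Qed.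

Let uw0 : Xu F - Xw F != 0. Proof. exact: mpolyX_neq. Qed.
Let uv0 : Xu F - Xv F != 0. Proof. exact: mpolyX_neq. Qed.
Let vw0 : Xv F - Xw F != 0. Proof. exact: mpolyX_neq. Qed.

Lemma QbarE (Q : {mpoly F[2]}) :
  (Xu F - Xw F) * Qbar Q = subst2 Q (Xu F) (Xv F) - subst2 Q (Xw F) (Xv F).
Proof.
have [|q Eq] := @merge_var_eq _ (@Ordinal 3 0 isT) (@Ordinal 3 2 isT)
  (subst2 Q (Xu F) (Xv F)) (subst2 Q (Xw F) (Xv F)).
  by rewrite !merge_var_subst2 !merge_varX.
by rewrite /Qbar -!tofracB (poly_of_frac_div uw0 Eq) -Eq.
Qed.

(* The three linear forms are pairwise coprime primes: dividing successively, *)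
(* each quotient still vanishes on the remaining hyperplanes. *)
Lemma vandermonde3_div (N : {mpoly F[3]}) :
  let o0 := @Ordinal 3 0 isT in let o1 := @Ordinal 3 1 isT in
  let o2 := @Ordinal 3 2 isT in
  merge_var o0 o1 N = 0 -> merge_var o0 o2 N = 0 -> merge_var o1 o2 N = 0 ->
  exists q, N = (Xu F - Xv F) * (Xu F - Xw F) * (Xv F - Xw F) * q.
Proof.
move=> o0 o1 o2 /merge_var_div[q1 ->] N02 N12.
have [|q2 Eq2] := @merge_var_div _ o0 o2 q1.
  move/eqP: N02; rewrite rmorphM mulf_eq0 rmorphB /= !merge_varX /= => /orP[|/eqP//].
  by rewrite (negPf (mpolyX_neq _)).
have [|q3 Eq3] := @merge_var_div _ o1 o2 q2.
  move/eqP: N12; rewrite Eq2 !rmorphM !mulf_eq0 !rmorphB /= !merge_varX /=.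
  by rewrite !(negPf (mpolyX_neq _)) //= => /eqP.
by exists q3; rewrite Eq2 Eq3 !mulrA.
Qed.

Lemma partial_fractions (E : fieldType) (u v w a b c : E) :
  u - v != 0 -> u - w != 0 -> v - w != 0 ->
  a / ((u - v) * (u - w)) + b / ((u - w) * (v - w)) + c / ((u - v) * (v - w)) =
  (a * (v - w) + b * (u - v) + c * (u - w)) / ((u - v) * (u - w) * (v - w)).
Proof. by move=> uv uw vw; field; rewrite vw uw uv. Qed.

(** On each of the three hyperplanes only two terms of the common numerator survive, and the
    hypotheses make them cancel. The fractions [a'], [b'], [c'] are separate so that they can match
    the products of fractions in [Pbar1] and [Pbar2]. *)
Lemma partial_fractions_poly (a b c x y z : {mpoly F[3]}) (a' b' c' : {fraction {mpoly F[3]}}) :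
  let u := Xu F in let v := Xv F in let w := Xw F in
  let o0 := @Ordinal 3 0 isT in let o1 := @Ordinal 3 1 isT in
  let o2 := @Ordinal 3 2 isT in
  a%:F = a' -> b%:F = b' -> c%:F = c' ->
  merge_var o0 o1 a = x -> merge_var o0 o1 c = - x ->
  merge_var o0 o2 a = y -> merge_var o0 o2 b = y ->
  merge_var o1 o2 b = z -> merge_var o1 o2 c = - z ->
  (u - v) * (u - w) * (v - w) *
  poly_of_frac (a' / ((u%:F - v%:F) * (u%:F - w%:F))
              + b' / ((u%:F - w%:F) * (v%:F - w%:F))
              + c' / ((u%:F - v%:F) * (v%:F - w%:F)))
  = a * (v - w) + b * (u - v) + c * (u - w).
Proof.
move=> u v w o0 o1 o2 <- <- <- ax cx ay by_ bz cz.
have D0 : (u - v) * (u - w) * (v - w) != 0 by rewrite !mulf_neq0.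
have mergeN i j : merge_var i j (a * (v - w) + b * (u - v) + c * (u - w))
  = merge_var i j a * (merge_var i j v - merge_var i j w)
    + merge_var i j b * (merge_var i j u - merge_var i j v)
    + merge_var i j c * (merge_var i j u - merge_var i j w).
  by rewrite !rmorphD !rmorphM !rmorphB.
have [|||q Eq] := @vandermonde3_div (a * (v - w) + b * (u - v) + c * (u - w)).
- by rewrite mergeN !merge_varX /= ax cx subrr mulr0 addr0 mulNr addrN.
- by rewrite mergeN !merge_varX /= ay by_ subrr mulr0 addr0 -mulrDr addrA subrK subrr mulr0.
- by rewrite mergeN !merge_varX /= bz cz subrr mulr0 add0r mulNr addrN.
rewrite partial_fractions; try by rewrite -tofracB tofrac_eq0.
rewrite -!tofracB -!tofracM -!tofracD.
by rewrite (poly_of_frac_div D0 Eq) -Eq.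
Qed.

Lemma merge3E :
  let o0 := @Ordinal 3 0 isT in let o1 := @Ordinal 3 1 isT in
  let o2 := @Ordinal 3 2 isT in
  ((merge_var o0 o1 (Xu F) = Xv F) * (merge_var o0 o1 (Xv F) = Xv F) *
   (merge_var o0 o1 (Xw F) = Xw F) * (merge_var o0 o2 (Xu F) = Xw F) *
   (merge_var o0 o2 (Xv F) = Xv F) * (merge_var o0 o2 (Xw F) = Xw F) *
   (merge_var o1 o2 (Xu F) = Xu F) * (merge_var o1 o2 (Xv F) = Xw F) *
   (merge_var o1 o2 (Xw F) = Xw F))%type.
Proof. by do 8?split; apply: merge_varX. Qed.

Lemma merge_var_subst2M (P : {mpoly F[2]}) n (i j : 'I_n) a b c e :
  merge_var i j (subst2 P a b * subst2 P c e) =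
  subst2 P (merge_var i j a) (merge_var i j b)
  * subst2 P (merge_var i j c) (merge_var i j e).
Proof. by rewrite merge_varM !merge_var_subst2. Qed.

Lemma merge_var_subst2MN (P : {mpoly F[2]}) n (i j : 'I_n) a b c e :
  merge_var i j (- (subst2 P a b * subst2 P c e)) =
  - (subst2 P (merge_var i j a) (merge_var i j b)
     * subst2 P (merge_var i j c) (merge_var i j e)).
Proof. by rewrite merge_varN merge_var_subst2M. Qed.

Lemma tofracMN n (a b : {mpoly F[n]}) :
  (- (a * b))%:F = - (a%:F * b%:F) :> {fraction {mpoly F[n]}}.
Proof. exact: etrans (tofracN _) (congr1 -%R (tofracM _ _)). Qed.

Lemma Pbar1E (P : {mpoly F[2]}) :
  let p := subst2 P in let u := Xu F in let v := Xv F in let w := Xw F in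
  (u - v) * (u - w) * (v - w) * Pbar1 P =
  p v u * p u w * (v - w) + p u w * p v w * (u - v) + - (p u v * p v w) * (u - w).
Proof.
move=> p u v w.
rewrite -(@partial_fractions_poly (p v u * p u w) (p u w * p v w) (- (p u v * p v w))
  (p v v * p v w) (p v w * p w w) (p u w * p w w)
  _ _ _ (tofracM _ _) (tofracM _ _) (tofracMN _ _)).
- by rewrite mulNr.
- by rewrite merge_var_subst2M !merge3E.
- by rewrite merge_var_subst2MN !merge3E.
- by rewrite merge_var_subst2M !merge3E.
- by rewrite merge_var_subst2M !merge3E; exact: mulrC.
- by rewrite merge_var_subst2M !merge3E.
- by rewrite merge_var_subst2MN !merge3E.
Qed.

Lemma Pbar2E (P : {mpoly F[2]}) :
  let p := subst2 P in let u := Xu F in let v := Xv F in let w := Xw F in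
  (u - v) * (u - w) * (v - w) * Pbar2 P =
  - (p u v * p u w) * (v - w) + - (p u w * p w v) * (u - v) + p u v * p v w * (u - w).
Proof.
move=> p u v w.
rewrite -(@partial_fractions_poly (- (p u v * p u w)) (- (p u w * p w v)) (p u v * p v w)
  (- (p v v * p v w)) (- (p w v * p w w)) (- (p u w * p w w))
  _ _ _ (tofracMN _ _) (tofracMN _ _) (tofracM _ _)).
- by rewrite !mulNr.
- by rewrite merge_var_subst2MN !merge3E.
- by rewrite opprK merge_var_subst2M !merge3E.
- by rewrite merge_var_subst2MN !merge3E.
- by rewrite merge_var_subst2MN !merge3E; exact: congr1 (mulrC _ _).
- by rewrite merge_var_subst2MN !merge3E.
- by rewrite opprK merge_var_subst2M !merge3E.
Qed.

(* Dedekind's independence of characters. *)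
Lemma msym_independent n (s : seq 'S_n) (c : 'S_n -> {mpoly F[n]}) :
  uniq s -> (forall f, \sum_(w <- s) c w * msym w f = 0) -> {in s, forall w, c w = 0}.
Proof.
elim: s c => // v s IH c /= /andP[vs s_uniq] sum0.
have s0 w : w \in s -> c w = 0.
  move=> ws; have /existsP[k wk] : [exists k, w k != v k].
    apply: contraNT vs; rewrite negb_exists => /forallP wv.
    by suff <- : w = v by []; apply/permP => k; have := wv k; rewrite negbK => /eqP.
  (* The relation at ['X_k * f] minus ['X_(v k)] times the relation at [f] eliminates [v], while the
     factor at [w] stays nonzero by the choice of [k]. *)
  have sum0' f : \sum_(u <- s) c u * ('X_(u k) - 'X_(v k)) * msym u f = 0.
    transitivity (\sum_(u <- v :: s) c u * msym u ('X_k * f)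
                  - 'X_(v k) * \sum_(u <- v :: s) c u * msym u f).
      rewrite !big_cons mulrDr ['X_(v k) * \sum_(j <- s) _]mulr_sumr.
      rewrite rmorphM /= msymXU [c v * _]mulrCA.
      rewrite opprD addrACA subrr add0r -sumrB.
      by apply: eq_bigr => u _; rewrite msymM msymXU; ring.
    by rewrite !sum0 mulr0 subrr.
  have /eqP := IH _ s_uniq sum0' w ws.
  by rewrite mulf_eq0 (negPf (mpolyX_neq wk)) orbF => /eqP.
move=> w; rewrite inE => /orP[/eqP->|/s0//].
have := sum0 1; rewrite big_cons big_seq big1 => [|u /s0 ->]; last by rewrite mul0r.
by rewrite msym1 mulr1 addr0.
Qed.

End Polys.

(** * Modules over a presented algebra *)

Section FreeAction.

Variables (F : fieldType) (X : choiceType) (V : lmodType F).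
Variables (g : X -> {linear V -> V}).

Definition word_act (m : monalg.fmonom X) (v : V) : V := foldr g v m.

Lemma word_act_linear m : linear (word_act m).
Proof.
rewrite /word_act => c u v; case: m => m /=.
by elim: m => //= x m ->; rewrite linearP.
Qed.

HB.instance Definition _ m :=
  GRing.isLinear.Build F V V *:%R (word_act m) (word_act_linear m).

Lemma word_act1 v : word_act monalg.one v = v.
Proof. by rewrite /word_act monalg.fm1. Qed.

Lemma word_actM m1 m2 v :
  word_act (monalg.mul m1 m2) v = word_act m1 (word_act m2 v).
Proof. by rewrite /word_act monalg.fmM foldr_cat. Qed.

Lemma word_actU x v : word_act (monalg.fmu x) v = g x v.
Proof. by rewrite /word_act monalg.fmU. Qed.

Definition free_act (a : free_alg F X) (v : V) : V :=
  \sum_(m <- monalg.msupp a) monalg.mcoeff m a *: word_act m v.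

Lemma free_act_linear a : linear (free_act a).
Proof.
move=> c u v; rewrite /free_act scaler_sumr -big_split; apply: eq_bigr => m _ /=.
by rewrite linearP scalerDr !scalerA mulrC.
Qed.

HB.instance Definition _ a :=
  GRing.isLinear.Build F V V *:%R (free_act a) (free_act_linear a).

Lemma free_actEw (A : {fset monalg.fmonom X}) a v : (monalg.msupp a `<=` A)%fset ->
  free_act a v = \sum_(m <- A) monalg.mcoeff m a *: word_act m v.
Proof.
move=> aA; rewrite [LHS](big_fset_incl _ aA) //= => m _ /monalg.mcoeff_outdom ->.
by rewrite scale0r.
Qed.

Lemma free_act_linearl v : linear (free_act^~ v).
Proof.
move=> c a b /=; pose A := (monalg.msupp a `|` monalg.msupp b)%fset.
rewrite !(@free_actEw A) ?fsubsetUl ?fsubsetUr //; last first.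
  apply: fsubset_trans (monalg.msuppD_le _ _) _.
  exact: fsetSU (monalg.msuppZ_le _ _).
rewrite scaler_sumr -big_split; apply: eq_bigr => m _ /=.
by rewrite monalg.mcoeffD monalg.mcoeffZ scalerDl scalerA.
Qed.

(** The arguments are swapped so that linearity in the algebra element can be registered as a
    structure. *)
Definition free_act_at v (a : free_alg F X) : V := free_act a v.

HB.instance Definition _ v := GRing.isLinear.Build F (free_alg F X) V *:%R
  (free_act_at v) (free_act_linearl v).

Lemma free_actD a b v : free_act (a + b) v = free_act a v + free_act b v.
Proof. exact: (raddfD (free_act_at v)). Qed.

Lemma free_actB a b v : free_act (a - b) v = free_act a v - free_act b v.
Proof. exact: (raddfB (free_act_at v)). Qed.

Lemma free_actN a v : free_act (- a) v = - free_act a v.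
Proof. exact: (raddfN (free_act_at v)). Qed.

Lemma free_act0 v : free_act 0 v = 0.
Proof. exact: (raddf0 (free_act_at v)). Qed.

Lemma free_actZ c a v : free_act (c *: a) v = c *: free_act a v.
Proof. exact: (linearZZ (free_act_at v)). Qed.

Lemma free_act_sum J (r : seq J) (P : pred J) (a : J -> free_alg F X) v :
  free_act (\sum_(j <- r | P j) a j) v = \sum_(j <- r | P j) free_act (a j) v.
Proof. exact: (raddf_sum (free_act_at v)). Qed.

Lemma free_actU m c v : free_act (monalg.mkmalgU m c) v = c *: word_act m v.
Proof.
rewrite (free_actEw _ monalg.msuppU_le) big_seq_fset1.
by rewrite monalg.mcoeffUU.
Qed.

Lemma free_act_gen x v : free_act (free_gen F x) v = g x v.
Proof. by rewrite free_actU scale1r word_actU. Qed.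

Lemma free_act1 v : free_act 1 v = v.
Proof. by rewrite free_actU word_act1 scale1r. Qed.

Lemma free_algE (a : free_alg F X) :
  a = \sum_(m <- monalg.msupp a) monalg.mkmalgU m (monalg.mcoeff m a).
Proof. exact: monalg.monalgE. Qed.

Lemma free_actM a b v : free_act (a * b) v = free_act a (free_act b v).
Proof.
rewrite [in LHS](free_algE a) mulr_suml !free_act_sum [RHS]/free_act.
apply: eq_bigr => m _; rewrite [in LHS](free_algE b) mulr_sumr free_act_sum.
rewrite [free_act b v]/free_act !linear_sum /=; apply: eq_bigr => m' _.
rewrite [_ * _]monalg.fgmulUU free_actU word_actM linearZ scalerA.
by [].
Qed.

End FreeAction.

Section PresentedAction.

Variables (F : fieldType) (X : choiceType) (V : lmodType F).
Variables (rel : free_alg F X -> free_alg F X -> Prop).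
Variables (g : X -> {linear V -> V}).
Hypothesis g_rel : forall a b, rel a b -> forall v, free_act g a v = free_act g b v.

Definition presented_act (u : presented rel) (v : V) : V := free_act g (repr u) v.

(** The elements acting as zero form a two-sided ideal that contains the differences of the
    relations, so the representative [repr u] is immaterial. *)
Lemma presented_actE a v : presented_act (presented_pi rel a) v = free_act g a v.
Proof.
have ideal0 z : ideal_of (rel_diff rel) z -> forall v, free_act g z v = 0.
  elim=> {z} [_ [b [c [/g_rel E ->]]]||b c _ IHb _ IHc|b c e _ IHc] w.
  - by rewrite free_actB E subrr.
  - exact: free_act0.
  - by rewrite free_actD IHb IHc addr0.
  - by rewrite !free_actM IHc linear0.
apply/eqP; rewrite -subr_eq0 -free_actB; apply/eqP/ideal0/presented_eqP.
by rewrite reprK.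
Qed.

Lemma presented_piP (u : presented rel) : exists a, u = presented_pi rel a.
Proof. by exists (repr u); rewrite /presented_pi reprK. Qed.

Lemma presented_act_linear u : linear (presented_act u).
Proof. exact: free_act_linear. Qed.

Lemma presented_act_linearl v : linear (presented_act^~ v).
Proof.
move=> c u w; have [a ->] := presented_piP u; have [b ->] := presented_piP w.
by rewrite -linearP !presented_actE free_act_linearl.
Qed.

Lemma presented_act1 v : presented_act 1 v = v.
Proof. by rewrite -(rmorph1 (presented_pi rel)) presented_actE free_act1. Qed.

Lemma presented_actM u w v :
  presented_act (u * w) v = presented_act u (presented_act w v).
Proof.
have [a ->] := presented_piP u; have [b ->] := presented_piP w.
by rewrite -rmorphM !presented_actE free_actM.
Qed.

End PresentedAction.

Section PresentedSpan.

Variables (F : fieldType) (X : choiceType).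
Variables (rel : free_alg F X -> free_alg F X -> Prop).

(** Words arise from 1 by left multiplication with generators, and their images span the algebra. *)
Lemma presented_ind (S : presented rel -> Prop) :
  S 0 -> (forall c u v, S u -> S v -> S (c *: u + v)) ->
  S 1 -> (forall x u, S u -> S (presented_pi rel (free_gen F x) * u)) ->
  forall u, S u.
Proof.
move=> S0 Slin S1 Sx u; have [a ->] := presented_piP u.
rewrite (free_algE a) linear_sum; elim/big_ind: _ => // [v w Sv Sw|m _].
  by rewrite -[v]scale1r; exact: Slin.
have -> : monalg.mkmalgU m (monalg.mcoeff m a) =
    monalg.mcoeff m a *: monalg.mkmalgU m 1 :> free_alg F X.
  by apply/monalg.malgP => k; rewrite monalg.mcoeffZ !monalg.mcoeffU mulr_natr.
rewrite linearZ /= -[_ *: _]addr0; apply: (Slin) S0.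
case: m {a u} => m; elim: m => [|x m IH].
  by rewrite -[monalg.FMonom [::]]monalg.fmE -/(monalg.fmone X) (rmorph1 (presented_pi rel)).
have -> : monalg.mkmalgU (monalg.FMonom (x :: m)) 1 =
    free_gen F x * monalg.mkmalgU (monalg.FMonom m) 1 :> free_alg F X.
  rewrite [_ * _]monalg.fgmulUU mulr1; congr monalg.mkmalgU.
  by apply/val_inj; rewrite /= monalg.fmM monalg.fmU.
by rewrite rmorphM; exact: Sx.
Qed.

End PresentedSpan.

(** * The polynomial representation *)

(** Neither of two distant reflections moves the variables of the other, so the same coefficients
    occur before and after transport and both orders of composition clear to one expression. *)
Lemma commuting_cleared (R : comPzRingType) (ds dt As Bs At Bt : R)
    (f fs ft fst u tu tau_u w sw tau_w : R) :
  ds * u = As * fs + Bs * f -> ds * tu = As * fst + Bs * ft ->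
  dt * tau_u = At * tu + Bt * u ->
  dt * w = At * ft + Bt * f -> dt * sw = At * fst + Bt * fs ->
  ds * tau_w = As * sw + Bs * w ->
  dt * (ds * tau_u) = dt * (ds * tau_w).
Proof.
move=> Eu Etu E1 Ew Esw E2; rewrite mulrCA E1 E2.
transitivity (At * (ds * tu) + Bt * (ds * u)); first by ring.
transitivity (As * (dt * sw) + Bs * (dt * w)); last by ring.
by rewrite Etu Eu Esw Ew; ring.
Qed.

Section TauOperators.

Variables (F : fieldType) (I : countType) (D : cartan_datum I).
Variables (K : klr_datum F D) (prec : rel I).
Hypothesis hprec : strict_total_order prec.
Variable d : nat.

Local Notation Q := (Qpoly K).
Local Notation P := (Ppoly K).
Implicit Types (s t : 'I_d.-1) (a b c : I) (f g u v : {mpoly F[d]}).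

(** The two colours are parameters, so the relations can be checked on plain polynomials; sequences
    return in [tau_at]. *)
Definition tau_op t a b f : {mpoly F[d]} :=
  if a == b then subst2 (P a) 'X_(pos t) 'X_(posS t) * demazure t f
  else if prec b a then subst2 (Q b a) 'X_(pos t) 'X_(posS t) * refl_poly t f
  else refl_poly t f.

(** Coefficient of the reflected polynomial in [root_diff F t * tau_op t a b f], as [tauB] is that
    of [f] itself. The variables are arguments because permutations will move them. *)
Definition tauA a b u v : {mpoly F[d]} :=
  if a == b then subst2 (P a) u v
  else if prec b a then (u - v) * subst2 (Q b a) u v else u - v.

Definition tauB a b u v : {mpoly F[d]} := if a == b then - subst2 (P a) u v else 0.

Lemma msym_tauA w a b u v : msym w (tauA a b u v) = tauA a b (msym w u) (msym w v).
Proof.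
by rewrite /tauA; case: ifP => _; [|case: ifP => _];
  rewrite ?rmorphM ?rmorphB /= ?msym_subst2.
Qed.

Lemma msym_tauB w a b u v : msym w (tauB a b u v) = tauB a b (msym w u) (msym w v).
Proof.
rewrite /tauB; case: ifP => _; last exact: rmorph0.
by rewrite -msym_subst2; exact: rmorphN.
Qed.

(* Clearing the denominator of the Demazure operator gives the three cases of *)
(* the action of [tau t] the same shape. *)
Lemma tau_opE t a b f :
  root_diff F t * tau_op t a b f
  = tauA a b 'X_(pos t) 'X_(posS t) * refl_poly t f
    + tauB a b 'X_(pos t) 'X_(posS t) * f.
Proof.
rewrite /tau_op /tauA /tauB /root_diff; case: ifP => _; last first.
  by case: ifP => _; rewrite mul0r addr0 ?mulrA.
by rewrite mulrCA demazureE mulrBr mulNr.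
Qed.

Lemma tau_op_msym (w : 'S_d) t a b f :
  ('X_(w (pos t)) - 'X_(w (posS t))) * msym w (tau_op t a b f)
  = tauA a b 'X_(w (pos t)) 'X_(w (posS t)) * msym w (refl_poly t f)
    + tauB a b 'X_(w (pos t)) 'X_(w (posS t)) * msym w f.
Proof.
have := congr1 (msym w) (tau_opE t a b f).
by rewrite rmorphD !rmorphM rmorphB /= msym_tauA msym_tauB !msymXU.
Qed.

Lemma refl_polyK t f : refl_poly t (refl_poly t f) = f.
Proof. by rewrite /refl_poly -msymMm simple_reflK msym1m. Qed.

Lemma refl_polyM t f g : refl_poly t (f * g) = refl_poly t f * refl_poly t g.
Proof. exact: rmorphM. Qed.

Lemma tau_op_linear t a b : linear (tau_op t a b).
Proof.
move=> k f g; apply: (mulfI (root_diff_neq0 F t)).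
rewrite mulrDr -scalerAr !tau_opE /refl_poly linearP /= scalerDr.
by rewrite !mulrDr -!scalerAr addrACA.
Qed.

HB.instance Definition _ t a b :=
  GRing.isLinear.Build F {mpoly F[d]} {mpoly F[d]} *:%R (tau_op t a b) (tau_op_linear t a b).

(** The divided difference [demazure t f] is symmetric in the two variables, so it passes through a
    second [demazure t] as a scalar. *)
Lemma tau_op_square t a f :
  tau_op t a a (tau_op t a a f)
  = demazure t (subst2 (P a) 'X_(pos t) 'X_(posS t)) * tau_op t a a f.
Proof.
have dem_refl (h : {mpoly F[d]}) : refl_poly t (demazure t h) = demazure t h.
  apply: (mulfI (root_diff_neq0 F t)); rewrite demazureE.
  have := congr1 (refl_poly t) (demazureE t h); rewrite /refl_poly rmorphM /=.
  rewrite !rmorphB /= !msymXU /simple_refl tpermL tpermR => E.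
  rewrite -[RHS]opprB -[X in X - _](refl_polyK t h) /refl_poly -E /root_diff.
  by ring.
rewrite {1 2 3}/tau_op eqxx; apply: (mulfI (root_diff_neq0 F t)).
set p := subst2 _ _ _; set h := demazure t f.
rewrite mulrCA demazureE [refl_poly t (p * h)]rmorphM /= -/(refl_poly t h) dem_refl.
by rewrite [root_diff F t * _]mulrA demazureE /refl_poly -/h; ring.
Qed.

Lemma prec_asym a b : a != b -> prec b a = ~~ prec a b.
Proof.
case: hprec => irr tr tot ab; have := tot _ _ ab.
case: (boolP (prec a b)) => // pab _; apply/negP => pba.
by have := tr _ _ _ pab pba; rewrite irr.
Qed.

Lemma Qpoly_swap a b u v : subst2 (Q a b) u v = subst2 (Q b a) v u.
Proof. by rewrite Qpoly_sym subst2_swap. Qed.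

(** Exactly one of the two orders of the colours carries the factor Q. *)
Lemma tauA_tauA a b u v : a != b ->
  tauA a b u v * tauA b a v u = - ((u - v) * (u - v) * subst2 (Q a b) v u).
Proof.
move=> ab; rewrite /tauA [b == a]eq_sym (negPf ab) (prec_asym ab).
by case: (prec a b) => /=; rewrite ?(Qpoly_swap b a); ring.
Qed.

Lemma tau_op_square_neq t a b f : a != b ->
  tau_op t b a (tau_op t a b f) = subst2 (Q a b) 'X_(pos t) 'X_(posS t) * f.
Proof.
move=> ab; rewrite /tau_op [b == a]eq_sym (negPf ab) (prec_asym ab).
case: (prec a b) => /=; first by rewrite refl_polyK.
rewrite refl_polyM refl_polyK /refl_poly msym_subst2 !msymXU.
by rewrite /simple_refl tpermL tpermR Qpoly_swap.
Qed.

Lemma tau_op_mulX t a b (k : 'I_d) f :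
  tau_op t a b ('X_k * f) - 'X_(simple_refl t k) * tau_op t a b f
  = (if (k == pos t) && (a == b) then - subst2 (P a) 'X_(pos t) 'X_(posS t)
     else if (k == posS t) && (a == b) then subst2 (P a) 'X_(pos t) 'X_(posS t)
     else 0) * f.
Proof.
apply: (mulfI (root_diff_neq0 F t)); rewrite mulrBr [_ * ('X_ _ * _)]mulrCA !tau_opE.
rewrite /refl_poly rmorphM /= msymXU /tauB /root_diff.
case: (eqVneq a b) => _; rewrite !(andbT, andbF); last by ring.
case: (eqVneq k (pos t)) => [->|kt]; first by rewrite /simple_refl tpermL /tauA; ring.
case: (eqVneq k (posS t)) => [->|kt']; first by rewrite /simple_refl tpermR; ring.
by rewrite /simple_refl tpermD 1?eq_sym //; ring.
Qed.

Lemma tau_opC s t a b a' b' f : (s.+1 < t)%N || (t.+1 < s)%N ->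
  tau_op t a b (tau_op s a' b' f) = tau_op s a' b' (tau_op t a b f).
Proof.
move=> st; have E (x y : 'I_d.-1) : (x.+1 < y)%N || (y.+1 < x)%N ->
    simple_refl x (pos y) = pos y /\ simple_refl x (posS y) = posS y.
  by move=> xy; split; rewrite tpermD //; apply/eqP => /(congr1 val) /=; lia.
have [s1 s2] := E s t st; have [|t1 t2] := E t s; first by rewrite orbC.
apply: (mulfI (root_diff_neq0 F s)); apply: (mulfI (root_diff_neq0 F t)).
have Et := tau_op_msym (simple_refl t) s a' b' f.
have Es := tau_op_msym (simple_refl s) t a b f.
rewrite t1 t2 in Et; rewrite s1 s2 in Es.
have rC : msym (simple_refl t) (msym (simple_refl s) f)
        = msym (simple_refl s) (msym (simple_refl t) f).
  by rewrite -!msymMm simple_reflC.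
rewrite [msym _ (refl_poly _ _)]rC in Et.
exact: commuting_cleared (tau_opE s a' b' f) Et (tau_opE t a b _)
  (tau_opE t a b f) Es (tau_opE s a' b' _).
Qed.

End TauOperators.

(* The two sides of the braid relation, with denominators cleared.  [A12yz] *)
(* stands for [tauA] at the first two colours and at the variables y and z, *)
(* [g1], [g2], [g3] for the successive results, a prefix s or t for the action *)
(* of the first or second reflection, and [f12] for s (t f). *)
Lemma braid_left (R : comPzRingType) (x y z f f1 f2 f12 f21 fw : R)
    (A12yz B12yz A13xz B13xz A13xy B13xy A23yz B23yz A23xz B23xz A23xy B23xy
     A23zy B23zy : R) (g1 sg1 tg1 tsg1 g2 tg2 g3 : R) :
  (y - z) * g1 = A23yz * f2 + B23yz * f ->
  (x - z) * sg1 = A23xz * f12 + B23xz * f1 ->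
  (z - y) * tg1 = A23zy * f + B23zy * f2 ->
  (x - y) * tsg1 = A23xy * fw + B23xy * f21 ->
  (x - y) * g2 = A13xy * sg1 + B13xy * g1 ->
  (x - z) * tg2 = A13xz * tsg1 + B13xz * tg1 ->
  (y - z) * g3 = A12yz * tg2 + B12yz * g2 ->
  (x - y) * (x - z) * (y - z) * ((y - z) * g3) =
    (y - z) * (A12yz * A13xz * (A23xy * fw + B23xy * f21)
               + B12yz * A13xy * (A23xz * f12 + B23xz * f1))
    - (x - y) * A12yz * B13xz * (A23zy * f + B23zy * f2)
    + (x - z) * B12yz * B13xy * (A23yz * f2 + B23yz * f).
Proof.
move=> E1 E2 E3 E4 E5 E6 ->; rewrite -E1 -E2 -E3 -E4.
have -> : (x - y) * (x - z) * (y - z) * (A12yz * tg2 + B12yz * g2) =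
  (x - y) * (y - z) * A12yz * ((x - z) * tg2)
  + (x - z) * (y - z) * B12yz * ((x - y) * g2) by ring.
by rewrite E5 E6; ring.
Qed.

Lemma braid_right (R : comPzRingType) (x y z f f1 f2 f12 f21 fw : R)
    (A12yz B12yz A12xz B12xz A12xy B12xy A12yx B12yx A13xz B13xz A13yz B13yz
     A23xy B23xy : R) (h1 th1 sh1 sth1 h2 sh2 h3 : R) :
  (x - y) * h1 = A12xy * f1 + B12xy * f ->
  (x - z) * th1 = A12xz * f21 + B12xz * f2 ->
  (y - x) * sh1 = A12yx * f + B12yx * f1 ->
  (y - z) * sth1 = A12yz * fw + B12yz * f12 ->
  (y - z) * h2 = A13yz * th1 + B13yz * h1 ->
  (x - z) * sh2 = A13xz * sth1 + B13xz * sh1 ->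
  (x - y) * h3 = A23xy * sh2 + B23xy * h2 ->
  (x - y) * (x - z) * (y - z) * ((x - y) * h3) =
    (x - y) * (A23xy * A13xz * (A12yz * fw + B12yz * f12)
               + B23xy * A13yz * (A12xz * f21 + B12xz * f2))
    - (y - z) * A23xy * B13xz * (A12yx * f + B12yx * f1)
    + (x - z) * B23xy * B13yz * (A12xy * f1 + B12xy * f).
Proof.
move=> E1 E2 E3 E4 E5 E6 ->; rewrite -E1 -E2 -E3 -E4.
have -> : (x - y) * (x - z) * (y - z) * (A23xy * sh2 + B23xy * h2) =
  (x - y) * (y - z) * A23xy * ((x - z) * sh2)
  + (x - y) * (x - z) * B23xy * ((y - z) * h2) by ring.
by rewrite E5 E6; ring.
Qed.

Lemma braid_combine (R : comPzRingType) (x y z g h u v : R) :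
  (x - y) * (x - z) * (y - z) * ((y - z) * g) = u ->
  (x - y) * (x - z) * (y - z) * ((x - y) * h) = v ->
  (x - y) * (x - z) * (y - z) * (x - y) * (y - z) * (g - h) = (x - y) * u - (y - z) * v.
Proof. by move=> <- <-; ring. Qed.

Lemma rmorph_vandermonde3 (S R : comPzRingType) (phi : {rmorphism S -> R})
    (u v w q a b c : S) (x y z a' b' c' : R) :
  (u - v) * (u - w) * (v - w) * q = a * (v - w) + b * (u - v) + c * (u - w) ->
  phi u = x -> phi v = y -> phi w = z -> phi a = a' -> phi b = b' -> phi c = c' ->
  (x - y) * (x - z) * (y - z) * phi q = a' * (y - z) + b' * (x - y) + c' * (x - z).
Proof.
move=> /(congr1 phi) E <- <- <- <- <- <-; move: E.
by rewrite !rmorphD !rmorphM !rmorphB.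
Qed.

(** The terms in [fw], [f12] and [f21] cancel; the rest regroups into the cleared numerators of
    [Pbar1] and [Pbar2]. *)
Lemma braid_same_color (R : comPzRingType) (x y z f f1 f2 f12 f21 fw : R)
    (pxy pyx pxz pyz pzy h1 h2 q1 q2 : R) :
  (x - y) * h1 = pxy * f1 + - pxy * f ->
  (y - z) * h2 = pyz * f2 + - pyz * f ->
  (x - y) * (x - z) * (y - z) * q1 =
    pyx * pxz * (y - z) + pxz * pyz * (x - y) + - (pxy * pyz) * (x - z) ->
  (x - y) * (x - z) * (y - z) * q2 =
    - (pxy * pxz) * (y - z) + - (pxz * pzy) * (x - y) + pxy * pyz * (x - z) ->
  (x - y) * ((y - z) * (pyz * pxz * (pxy * fw + - pxy * f21)
               + - pyz * pxy * (pxz * f12 + - pxz * f1))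
    - (x - y) * pyz * - pxz * (pzy * f + - pzy * f2)
    + (x - z) * - pyz * - pxy * (pyz * f2 + - pyz * f))
  - (y - z) * ((x - y) * (pxy * pxz * (pyz * fw + - pyz * f12)
               + - pxy * pyz * (pxz * f21 + - pxz * f2))
    - (y - z) * pxy * - pxz * (pyx * f + - pyx * f1)
    + (x - z) * - pxy * - pyz * (pxy * f1 + - pxy * f)) =
  (x - y) * (x - z) * (y - z) * (x - y) * (y - z) * (q1 * h1 + q2 * h2).
Proof.
move=> E1 E2 E3 E4; transitivity ((x - y) * (x - z) * (y - z) * q1 * ((x - y) * h1) * (y - z)
  + (x - y) * (x - z) * (y - z) * q2 * ((y - z) * h2) * (x - y)); last by ring.
by rewrite E1 E2 E3 E4; ring.
Qed.

Lemma braid_first_pair (R : comPzRingType) (x y z f f1 f12 f2 f21 fw : R)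
    (pyz pxz pxy pyx a1 a2 a3 a4 a5 : R) :
  (x - y) * ((y - z) * (pyz * a1 * (a2 * fw + 0 * f21)
               + - pyz * a2 * (a1 * f12 + 0 * f1))
    - (x - y) * pyz * 0 * (a3 * f + 0 * f2)
    + (x - z) * - pyz * 0 * (a4 * f2 + 0 * f))
  - (y - z) * ((x - y) * (a2 * a1 * (pyz * fw + - pyz * f12)
               + 0 * a5 * (pxz * f21 + - pxz * f2))
    - (y - z) * a2 * 0 * (pyx * f + - pyx * f1)
    + (x - z) * 0 * 0 * (pxy * f1 + - pxy * f)) = 0.
Proof. by ring. Qed.

Lemma braid_outer_pair (R : comPzRingType) (x y z f f1 f12 f2 f21 fw : R)
    (p p' p'' ayz bxy bxz byz bzy axz axy ayx q q' qb : R) :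
  ayz * bzy = - ((y - z) * (y - z) * q') ->
  bxy * ayx = - ((x - y) * (x - y) * q) ->
  (x - z) * qb = q - q' ->
  (x - y) * ((y - z) * (ayz * p * (bxy * fw + 0 * f21) + 0 * p' * (bxz * f12 + 0 * f1))
    - (x - y) * ayz * - p * (bzy * f + 0 * f2)
    + (x - z) * 0 * - p' * (byz * f2 + 0 * f))
  - (y - z) * ((x - y) * (bxy * p * (ayz * fw + 0 * f12) + 0 * p'' * (axz * f21 + 0 * f2))
    - (y - z) * bxy * - p * (ayx * f + 0 * f1)
    + (x - z) * 0 * - p'' * (axy * f1 + 0 * f)) =
  (x - y) * (x - z) * (y - z) * (x - y) * (y - z) * (p * qb * f).
Proof.
move=> E1 E2 E3.
transitivity ((x - y) * (x - y) * (ayz * bzy) * p * f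
  - (y - z) * (y - z) * (bxy * ayx) * p * f); first by ring.
rewrite E1 E2.
transitivity ((x - y) * (x - y) * (y - z) * (y - z) * p * f * ((x - z) * qb)); last by ring.
by rewrite E3; ring.
Qed.

(** The first colour differs from the other two. The hypothesis covers both remaining cases: [b1]
    vanishes if these two differ, the bracket if they agree. *)
Lemma braid_other (R : comPzRingType) (x y z f f1 f12 f2 f21 fw : R)
    (a1 a2 a3 a4 a5 a6 a7 a8 a9 a10 a11 b1 b2 b3 b4 : R) :
  b1 * (a1 * a2 * f21 - a8 * (a9 * f21)) = 0 ->
  (x - y) * ((y - z) * (a1 * a2 * (a3 * fw + b1 * f21) + 0 * a4 * (a5 * f12 + b2 * f1))
    - (x - y) * a1 * 0 * (a6 * f + b3 * f2)
    + (x - z) * 0 * 0 * (a7 * f2 + b4 * f))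
  - (y - z) * ((x - y) * (a3 * a2 * (a1 * fw + 0 * f12) + b1 * a8 * (a9 * f21 + 0 * f2))
    - (y - z) * a3 * 0 * (a10 * f + 0 * f1)
    + (x - z) * b1 * 0 * (a11 * f1 + 0 * f)) = 0.
Proof.
move=> E; transitivity ((x - y) * (y - z) * (b1 * (a1 * a2 * f21 - a8 * (a9 * f21)))).
  by ring.
by rewrite E mulr0.
Qed.

(** * The braid relation for the polynomial operators *)

Section Braid.

Variables (F : fieldType) (I : countType) (D : cartan_datum I).
Variables (K : klr_datum F D) (prec : rel I).
Hypothesis hprec : strict_total_order prec.
Variable d : nat.

Local Notation Q := (Qpoly K).
Local Notation P := (Ppoly K).
Local Notation tau := (tau_op K prec).
Local Notation A := (tauA K prec).
Local Notation B := (tauB K).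

Variables (t t1 : 'I_d.-1).
Hypothesis tt1 : t1 = t.+1 :> nat.
Implicit Types (a b c : I) (f g : {mpoly F[d]}).

Let x : {mpoly F[d]} := 'X_(pos t).
Let y : {mpoly F[d]} := 'X_(posS t).
Let z : {mpoly F[d]} := 'X_(posS t1).

Let pos_t1 : pos t1 = posS t. Proof. exact/val_inj. Qed.

Let s : 'S_d := simple_refl t.
Let r : 'S_d := simple_refl t1.

Let neqs : [/\ pos t != posS t, pos t != posS t1 & posS t != posS t1].
Proof. by split; apply/eqP => /(congr1 val) /=; lia. Qed.

Let sE : [/\ s (pos t) = posS t, s (posS t) = pos t & s (posS t1) = posS t1].
Proof.
have [_ n1 n2] := neqs.
by split; rewrite /s /simple_refl ?tpermL ?tpermR ?tpermD.
Qed.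

Let rE : [/\ r (pos t) = pos t, r (posS t) = posS t1 & r (posS t1) = posS t].
Proof.
have [n1 n2 _] := neqs.
by split; rewrite /r /simple_refl pos_t1 ?tpermL ?tpermR ?tpermD // eq_sym.
Qed.

(** Besides the Vandermonde product, the first composite needs an extra factor [y - z] and the
    second an extra [x - y]; this gives the common multiplier. *)
Lemma braid_cleared a b c f :
  let f1 := msym s f in let f2 := msym r f in
  let f12 := msym s f2 in let f21 := msym r f1 in let fw := msym r f12 in
  (x - y) * (x - z) * (y - z) * (x - y) * (y - z) *
  (tau t1 a b (tau t a c (tau t1 b c f)) - tau t b c (tau t1 a c (tau t a b f))) =
    (x - y) * ((y - z) * (A a b y z * A a c x z * (A b c x y * fw + B b c x y * f21)
               + B a b y z * A a c x y * (A b c x z * f12 + B b c x z * f1))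
    - (x - y) * A a b y z * B a c x z * (A b c z y * f + B b c z y * f2)
    + (x - z) * B a b y z * B a c x y * (A b c y z * f2 + B b c y z * f))
  - (y - z) * ((x - y) * (A b c x y * A a c x z * (A a b y z * fw + B a b y z * f12)
               + B b c x y * A a c y z * (A a b x z * f21 + B a b x z * f2))
    - (y - z) * A b c x y * B a c x z * (A a b y x * f + B a b y x * f1)
    + (x - z) * B b c x y * B a c y z * (A a b x y * f1 + B a b x y * f)).
Proof.
move=> f1 f2 f12 f21 fw.
have [s1 s2 s3] := sE; have [r1 r2 r3] := rE.
have Et (w : 'S_d) i j h : ('X_(w (pos t)) - 'X_(w (posS t))) * msym w (tau t i j h)
    = A i j 'X_(w (pos t)) 'X_(w (posS t)) * msym w (msym s h)
      + B i j 'X_(w (pos t)) 'X_(w (posS t)) * msym w h.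
  exact: tau_op_msym.
have Et1 (w : 'S_d) i j h : ('X_(w (posS t)) - 'X_(w (posS t1))) * msym w (tau t1 i j h)
    = A i j 'X_(w (posS t)) 'X_(w (posS t1)) * msym w (msym r h)
      + B i j 'X_(w (posS t)) 'X_(w (posS t1)) * msym w h.
  by have := tau_op_msym K prec w t1 i j h; rewrite pos_t1.
have fwE : msym s f21 = fw.
  by rewrite /f21 /fw /f12 /f1 /f2 -!msymMm mulgA (simple_refl_braid tt1) -mulgA.
have ssf (h : {mpoly F[d]}) : msym s (msym s h) = h by exact: refl_polyK.
have rrf (h : {mpoly F[d]}) : msym r (msym r h) = h by exact: refl_polyK.
set g1 := tau t1 b c f; set g2 := tau t a c g1; set g3 := tau t1 a b g2.
set h1 := tau t a b f; set h2 := tau t1 a c h1; set h3 := tau t b c h2.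
have Et0 i j h : (x - y) * tau t i j h = A i j x y * msym s h + B i j x y * h.
  exact: tau_opE.
have Et10 i j h : (y - z) * tau t1 i j h = A i j y z * msym r h + B i j y z * h.
  by have := tau_opE K prec t1 i j h; rewrite /root_diff pos_t1.
have Etr i j h : (x - z) * msym r (tau t i j h)
    = A i j x z * msym r (msym s h) + B i j x z * msym r h.
  by have := Et r i j h; rewrite r1 r2.
have Et1s i j h : (x - z) * msym s (tau t1 i j h)
    = A i j x z * msym s (msym r h) + B i j x z * msym s h.
  by have := Et1 s i j h; rewrite s2 s3.
have Ets i j h : (y - x) * msym s (tau t i j h) = A i j y x * h + B i j y x * msym s h.
  by have := Et s i j h; rewrite s1 s2 ssf.
have Et1r i j h : (z - y) * msym r (tau t1 i j h) = A i j z y * h + B i j z y * msym r h.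
  by have := Et1 r i j h; rewrite r2 r3 rrf.
have Et_sr : (y - z) * msym s (msym r h1) = A a b y z * fw + B a b y z * f12.
  have := Et (r * s)%g a b f; rewrite !permM r1 r2 s1 s3.
  by rewrite !(msymMm _ r s) -/f1 -/f2 -/f21 fwE.
have Et1_rs : (x - y) * msym r (msym s g1) = A b c x y * fw + B b c x y * f21.
  have := Et1 (s * r)%g b c f; rewrite !permM s2 s3 r1 r3.
  by rewrite !(msymMm _ s r).
have L := braid_left (Et10 b c f) (Et1s b c f) (Et1r b c f) Et1_rs (Et0 a c g1)
  (Etr a c g1) (Et10 a b g2).
have R := braid_right (Et0 a b f) (Etr a b f) (Ets a b f) Et_sr (Et10 a c h1)
  (Et1s a c h1) (Et0 b c h2).
exact: braid_combine L R.
Qed.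

Let xy0 : x - y != 0. Proof. by have [n _ _] := neqs; exact: mpolyX_neq. Qed.
Let xz0 : x - z != 0. Proof. by have [_ n _] := neqs; exact: mpolyX_neq. Qed.
Let yz0 : y - z != 0. Proof. by have [_ _ n] := neqs; exact: mpolyX_neq. Qed.

Let vandermonde0 : (x - y) * (x - z) * (y - z) * (x - y) * (y - z) != 0.
Proof. by rewrite !mulf_neq0. Qed.

Lemma QbarXE (q : {mpoly F[2]}) :
  (x - z) * subst3 (Qbar q) x y z = subst2 q x y - subst2 q z y.
Proof.
have := congr1 (fun p => subst3 p x y z) (QbarE q); rewrite /= /subst3 rmorphM !rmorphB /=.
by rewrite -!/(subst3 _ _ _ _) !subst3_subst2 !subst3XU.
Qed.

Lemma subst3_subst2M n (p : {mpoly F[2]}) (q1 q2 q3 q4 : {mpoly F[3]})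
    (u v w : {mpoly F[n]}) :
  subst3 (subst2 p q1 q2 * subst2 p q3 q4) u v w =
  subst2 p (subst3 q1 u v w) (subst3 q2 u v w)
  * subst2 p (subst3 q3 u v w) (subst3 q4 u v w).
Proof. by rewrite -!subst3_subst2; exact: rmorphM. Qed.

Lemma subst3_subst2MN n (p : {mpoly F[2]}) (q1 q2 q3 q4 : {mpoly F[3]})
    (u v w : {mpoly F[n]}) :
  subst3 (- (subst2 p q1 q2 * subst2 p q3 q4)) u v w =
  - (subst2 p (subst3 q1 u v w) (subst3 q2 u v w)
     * subst2 p (subst3 q3 u v w) (subst3 q4 u v w)).
Proof. by rewrite -subst3_subst2M; exact: rmorphN. Qed.

Lemma PbarX1E (q : {mpoly F[2]}) : let p := subst2 q in
  (x - y) * (x - z) * (y - z) * subst3 (Pbar1 q) x y z =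
  p y x * p x z * (y - z) + p x z * p y z * (x - y) + - (p x y * p y z) * (x - z).
Proof.
apply: (rmorph_vandermonde3 (phi := comp_mpoly [tuple x; y; z]) (Pbar1E q)).
1-3: exact: comp_mpolyXU.
1-2: by apply: etrans (subst3_subst2M _ _ _ _ _ _ _ _) _; rewrite !subst3XU.
by apply: etrans (subst3_subst2MN _ _ _ _ _ _ _ _) _; rewrite !subst3XU.
Qed.

Lemma PbarX2E (q : {mpoly F[2]}) : let p := subst2 q in
  (x - y) * (x - z) * (y - z) * subst3 (Pbar2 q) x y z =
  - (p x y * p x z) * (y - z) + - (p x z * p z y) * (x - y) + p x y * p y z * (x - z).
Proof.
apply: (rmorph_vandermonde3 (phi := comp_mpoly [tuple x; y; z]) (Pbar2E q)).
1-3: exact: comp_mpolyXU.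
1-2: by apply: etrans (subst3_subst2MN _ _ _ _ _ _ _ _) _; rewrite !subst3XU.
by apply: etrans (subst3_subst2M _ _ _ _ _ _ _ _) _; rewrite !subst3XU.
Qed.

Lemma tau_op_braid a b c f :
  tau t1 a b (tau t a c (tau t1 b c f)) - tau t b c (tau t1 a c (tau t a b f)) =
  if (a == c) && (a != b) then subst2 (P a) x z * subst3 (Qbar (Q a b)) x y z * f
  else if (a == b) && (b == c) then
    subst3 (Pbar1 (P a)) x y z * tau t a b f + subst3 (Pbar2 (P a)) x y z * tau t1 b c f
  else 0.
Proof.
have E1 : (x - y) * tau t a b f = A a b x y * msym s f + B a b x y * f.
  exact: tau_opE.
have E2 : (y - z) * tau t1 b c f = A b c y z * msym r f + B b c y z * f.
  by have := tau_opE K prec t1 b c f; rewrite /root_diff pos_t1.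
have AE i (u v : {mpoly F[d]}) : A i i u v = subst2 (P i) u v by rewrite /tauA eqxx.
have BE i (u v : {mpoly F[d]}) : B i i u v = - subst2 (P i) u v by rewrite /tauB eqxx.
have B0 (i j : I) (u v : {mpoly F[d]}) : i != j -> B i j u v = 0 by rewrite /tauB => /negPf ->.
apply: (mulfI vandermonde0); rewrite braid_cleared.
case: (eqVneq a b) E1 E2 => [<- {b}|ab] E1 E2; rewrite ?andbT ?andbF /=.
  case: (eqVneq a c) E1 E2 => [<- {c}|ac] E1 E2.
    rewrite !AE !BE in E1 E2 *.
    exact: braid_same_color E1 E2 (PbarX1E _) (PbarX2E _).
  rewrite !(B0 a c) // !AE !BE [RHS]mulr0; exact: braid_first_pair.
case: (eqVneq a c) E1 E2 => [<- {c}|ac] E1 E2 /=.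
  have ba : b != a by rewrite eq_sym.
  rewrite !(B0 a b) // !(B0 b a) // !AE !BE.
  apply: braid_outer_pair (QbarXE _); first exact: tauA_tauA.
  by rewrite (Qpoly_swap K a b); exact: tauA_tauA.
rewrite !(B0 a b) // !(B0 a c) // [RHS]mulr0; apply: braid_other.
case: (eqVneq b c) => [<-|bc]; last by rewrite B0 // mul0r.
by rewrite mulrA subrr mulr0.
Qed.

End Braid.

(** * The defining relations on the space of polynomials indexed by sequences *)

Section PolRep.

Variables (F : fieldType) (I : countType) (D : cartan_datum I).
Variables (K : klr_datum F D) (prec : rel I).
Hypothesis hprec : strict_total_order prec.
Variable alpha : {mset I}.

Local Notation d := (height alpha).
Local Notation Q := (Qpoly K).
Local Notation P := (Ppoly K).
Local Notation Pol := (Pol F alpha).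
Local Notation refl t := (simple_refl t).
Implicit Types (i j : Seq alpha) (f g : {mpoly F[d]}) (v : Pol) (t s : 'I_d.-1).

Lemma Seq_act1 i : Seq_act 1%g i = i.
Proof. by apply/val_inj/eq_from_tnth => k; rewrite /= tnth_mktuple perm1. Qed.

Lemma Seq_act_reflK t i : Seq_act (refl t) (Seq_act (refl t) i) = i.
Proof. by rewrite -Seq_actM simple_reflK Seq_act1. Qed.

Lemma tnth_Seq_act (w : 'S_d) i k : tnth (Seq_act w i) k = tnth i (w k).
Proof. exact: tnth_mktuple. Qed.

Lemma Seq_act_tperm_id i k l : tnth i k = tnth i l -> Seq_act (tperm k l) i = i.
Proof.
move=> E; apply/val_inj/eq_from_tnth => x; rewrite tnth_Seq_act.
by case: tpermP => // ->.
Qed.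

Lemma Seq_act_refl_id t i :
  tnth i (pos t) = tnth i (posS t) -> Seq_act (refl t) i = i.
Proof. exact: Seq_act_tperm_id. Qed.

(** The triple product is the transposition of the two outer places, which carry the same colour. *)
Lemma Seq_act_braid_id t t1 i : t1 = t.+1 :> nat ->
  tnth i (pos t) = tnth i (posS t1) ->
  Seq_act (refl t1) (Seq_act (refl t) (Seq_act (refl t1) i)) = i.
Proof.
move=> tt1 E; rewrite -!Seq_actM.
suff -> : (refl t1 * refl t * refl t1)%g = tperm (pos t) (posS t1).
  exact: Seq_act_tperm_id.
have -> : (refl t1 * refl t * refl t1)%g = (refl t ^ refl t1)%g.
  by rewrite conjgE /simple_refl tpermV mulgA.
have E1 : pos t1 = posS t by apply/val_inj.
by rewrite /simple_refl tpermJ E1 tpermL tpermD //; apply/eqP => /(congr1 val) /=; lia.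
Qed.

Lemma pol_in_linear i : linear (@pol_in F I alpha i).
Proof.
move=> c f g; apply/ffunP => j; rewrite !ffunE.
by case: eqP => // _; rewrite scaler0 addr0.
Qed.

HB.instance Definition _ i :=
  GRing.isLinear.Build F {mpoly F[d]} Pol *:%R (@pol_in F I alpha i) (pol_in_linear i).

Lemma pol_in_eval i f j : pol_in i f j = if j == i then f else 0.
Proof. exact: ffunE. Qed.

Lemma pol_decomp v : v = \sum_i pol_in i (v i).
Proof.
apply/ffunP => j; rewrite sum_ffunE (bigD1 j) //= pol_in_eval eqxx.
rewrite big1 ?addr0 // => i ij; rewrite pol_in_eval eq_sym (negPf ij).
by [].
Qed.

Definition e_act j v : Pol := pol_in j (v j).
Definition x_act (k : 'I_d) v : Pol := [ffun i => 'X_k * v i].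

Definition tau_at t i f : {mpoly F[d]} :=
  tau_op K prec t (tnth i (pos t)) (tnth i (posS t)) f.

Definition tau_act t v : Pol := \sum_i pol_in (Seq_act (refl t) i) (tau_at t i (v i)).

Lemma e_act_linear j : linear (e_act j).
Proof. by move=> c u v; rewrite /e_act -linearP; congr pol_in; rewrite !ffunE. Qed.

Lemma x_act_linear k : linear (x_act k).
Proof.
move=> c u v; apply/ffunP => i; rewrite !ffunE mulrDr.
by rewrite scalerAr.
Qed.

Lemma tau_act_linear t : linear (tau_act t).
Proof.
move=> c u v; rewrite /tau_act scaler_sumr -big_split; apply: eq_bigr => i _ /=.
rewrite -linearP -[_ *: tau_at _ _ _ + _]tau_op_linear; congr (pol_in _ (tau_at _ _ _)).
by rewrite !ffunE.
Qed.

HB.instance Definition _ j := GRing.isLinear.Build F Pol Pol *:%R (e_act j) (e_act_linear j).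
HB.instance Definition _ k := GRing.isLinear.Build F Pol Pol *:%R (x_act k) (x_act_linear k).
HB.instance Definition _ t :=
  GRing.isLinear.Build F Pol Pol *:%R (tau_act t) (tau_act_linear t).

Definition gen_act (g : klr_gen alpha) : {linear Pol -> Pol} :=
  match g with
  | inl j => e_act j
  | inr (inl k) => x_act k
  | inr (inr t) => tau_act t
  end.

Local Notation act := (free_act gen_act).

Lemma eq_act_pol_in (a b : free_alg F (klr_gen alpha)) :
  (forall i f, act a (pol_in i f) = act b (pol_in i f)) -> forall v, act a v = act b v.
Proof.
by move=> E v; rewrite (pol_decomp v) !linear_sum; apply: eq_bigr => i _; exact: E.
Qed.

Lemma act_comp (a b : free_alg F (klr_gen alpha)) v v' w :
  act b v = v' -> act a v' = w -> act (a * b) v = w.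
Proof. by move=> <- <-; exact: free_actM. Qed.

Lemma act_e i f : act (gen_e F i) (pol_in i f) = pol_in i f.
Proof. by apply: etrans (free_act_gen _ _ _) _; rewrite /= /e_act pol_in_eval eqxx. Qed.

Lemma act_e_neq i j f : i != j -> act (gen_e F j) (pol_in i f) = 0.
Proof.
move=> ij; apply: etrans (free_act_gen _ _ _) _.
by rewrite /= /e_act pol_in_eval eq_sym (negPf ij) linear0.
Qed.

Lemma act_x k i f : act (gen_x F k) (pol_in i f) = pol_in i ('X_k * f).
Proof.
apply: etrans (free_act_gen _ _ _) _; apply/ffunP => j; rewrite !ffunE.
by case: eqP => // _; rewrite mulr0.
Qed.

Lemma act_tau t i f :
  act (gen_tau F t) (pol_in i f) = pol_in (Seq_act (refl t) i) (tau_at t i f).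
Proof.
apply: etrans (free_act_gen _ _ _) _.
rewrite /= /tau_act (bigD1 i) //= pol_in_eval eqxx big1 ?addr0 // => j ji.
by rewrite pol_in_eval (negPf ji) /tau_at !linear0.
Qed.

Lemma act_poly g i f : act (gen_poly g) (pol_in i f) = pol_in i (g * f).
Proof.
rewrite /gen_poly /mmap free_act_sum [in RHS](mpolyE g) mulr_suml linear_sum.
apply: eq_bigr => m _; apply: (@act_comp _ _ _ (pol_in i ('X_[m] * f))); last first.
  by rewrite free_actZ free_act1 -linearZ /= scalerAl.
rewrite mpolyXE_id /mmap1; elim/big_rec2: _ => [|k p a _ IH].
  by rewrite mul1r; exact: free_act1.
rewrite -mulrA; apply: act_comp IH _; elim: (m k) => [|n IHn].
  by rewrite !expr0 mul1r; exact: free_act1.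
by rewrite !exprS -mulrA; apply: act_comp IHn _; exact: act_x.
Qed.

(** The idempotent kills every component other than [i], so a relation multiplied by it need only be
    tested there. *)
Lemma act_right_idem (a b : free_alg F (klr_gen alpha)) i :
  (forall f, act a (pol_in i f) = act b (pol_in i f)) ->
  forall v, act (a * gen_e F i) v = act (b * gen_e F i) v.
Proof.
move=> E; apply: eq_act_pol_in => j f; case: (eqVneq j i) => [->|ji].
  apply: (etrans (act_comp (act_e i f) (E f))).
  exact: esym (act_comp (act_e i f) (erefl _)).
apply: (etrans (act_comp (act_e_neq f ji) (linear0 _))).
exact: esym (act_comp (act_e_neq f ji) (linear0 _)).
Qed.

(** Tracks the colours met by successive factors: [b c], [a c], [a b] in the first composite and
    [a b], [a c], [b c] in the second. *)
Lemma act_braid t t1 i f : t1 = t.+1 :> nat ->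
  let a := tnth i (pos t) in let b := tnth i (posS t) in let c := tnth i (posS t1) in
  act (gen_tau F t1 * gen_tau F t * gen_tau F t1
       - gen_tau F t * gen_tau F t1 * gen_tau F t) (pol_in i f) =
  pol_in (Seq_act (refl t1) (Seq_act (refl t) (Seq_act (refl t1) i)))
   (tau_op K prec t1 a b (tau_op K prec t a c (tau_op K prec t1 b c f))
    - tau_op K prec t b c (tau_op K prec t1 a c (tau_op K prec t a b f))).
Proof.
move=> tt1 a b c; rewrite free_actB linearB /=.
have E1 : pos t1 = posS t by apply/val_inj.
have far : [/\ pos t != posS t1, posS t1 != pos t, pos t != posS t & posS t != posS t1].
  by split; apply/eqP => /(congr1 val) /=; lia.
have [n1 n2 n3 n4] := far.
have s1 : refl t (posS t1) = posS t1 by rewrite /simple_refl tpermD // eq_sym.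
have r1 : refl t1 (pos t) = pos t by rewrite /simple_refl tpermD ?E1 // eq_sym.
have s2 : refl t (pos t) = posS t by rewrite /simple_refl tpermL.
have s3 : refl t (posS t) = pos t by rewrite /simple_refl tpermR.
have r2 : refl t1 (posS t) = posS t1 by rewrite /simple_refl E1 tpermL.
have r3 : refl t1 (posS t1) = posS t by rewrite /simple_refl tpermR E1.
congr (_ - _).
- apply: (act_comp (act_tau _ _ _)); apply: (act_comp (act_tau _ _ _)).
  apply: (etrans (act_tau _ _ _)).
  by rewrite /tau_at !tnth_Seq_act E1 !(s1, s2, s3, r1, r2, r3).
- apply: (act_comp (act_tau _ _ _)); apply: (act_comp (act_tau _ _ _)).
  apply: (etrans (act_tau _ _ _)).
  have -> : Seq_act (refl t1) (Seq_act (refl t) (Seq_act (refl t1) i)) =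
            Seq_act (refl t) (Seq_act (refl t1) (Seq_act (refl t) i)).
    by rewrite -!Seq_actM (simple_refl_braid tt1).
  by rewrite /tau_at !tnth_Seq_act E1 !(s1, s2, s3, r1, r2, r3).
Qed.

Lemma act_rel a b : klr_rel K a b -> forall v, act a v = act b v.
Proof.
case=> {a b}.
- move=> i j; apply: eq_act_pol_in => k f; case: (eqVneq k j) => [->|kj].
    case: (eqVneq i j) => [->|ij]; first exact: act_comp (act_e j f) _.
    rewrite free_act0; apply: act_comp (act_e j f) _.
    by apply: act_e_neq; rewrite eq_sym.
  apply: etrans (act_comp (act_e_neq f kj) (linear0 _)) _; apply: esym.
  by case: (eqVneq i j) => [->|ij]; [exact: act_e_neq | exact: free_act0].
- apply: eq_act_pol_in => k f; rewrite free_act_sum free_act1 (bigD1 k) //= act_e.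
  by rewrite big1 ?addr0 // => i ik; apply: act_e_neq; rewrite eq_sym.
- move=> k i; apply: eq_act_pol_in => j f; apply: etrans; last first.
    by apply: esym; apply: act_comp (act_x k j f) (erefl _).
  case: (eqVneq j i) => [->|ji]; first by rewrite act_e; exact: act_comp (act_e i f) (act_x _ _ _).
  by rewrite act_e_neq //; exact: act_comp (act_e_neq f ji) (linear0 _).
- move=> k l; apply: eq_act_pol_in => j f.
  apply: etrans (act_comp (act_x _ _ _) (act_x _ _ _)) _; rewrite mulrCA; apply: esym.
  exact: act_comp (act_x _ _ _) (act_x _ _ _).
- move=> t i; apply: eq_act_pol_in => j f; apply: etrans; last first.
    by apply: esym; apply: act_comp (act_tau t j f) (erefl _).
  case: (eqVneq j i) => [->|ji].
    by rewrite act_e; exact: act_comp (act_e i f) (act_tau _ _ _).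
  rewrite act_e_neq ?(can_eq (Seq_act_reflK t)) //.
  exact: act_comp (act_e_neq f ji) (linear0 _).
- move=> s t st; apply: eq_act_pol_in => j f.
  apply: etrans (act_comp (act_tau _ _ _) (act_tau _ _ _)) _; apply: esym.
  apply: etrans (act_comp (act_tau _ _ _) (act_tau _ _ _)) _.
  rewrite -!Seq_actM (simple_reflC st); congr pol_in.
  rewrite /tau_at !tnth_Seq_act.
  have far (x y : 'I_d.-1) : (x.+1 < y)%N || (y.+1 < x)%N ->
      refl x (pos y) = pos y /\ refl x (posS y) = posS y.
    by move=> xy; split; rewrite /simple_refl tpermD //; apply/eqP => /(congr1 val) /=; lia.
  have [-> ->] := far s t st; have [|-> ->] := far t s; first by rewrite orbC.
  by apply: tau_opC; rewrite // orbC.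
- move=> t i it it1; rewrite expr2.
  case: (eqVneq it it1) => [E|NE]; apply: act_right_idem => f.
    apply: etrans (act_comp (act_tau _ _ _) (act_tau _ _ _)) _; apply: esym.
    apply: etrans (act_comp (act_tau _ _ _) (act_poly _ _ _)) _.
    rewrite !(Seq_act_refl_id E); congr pol_in.
    by rewrite /tau_at -/it -/it1 -E; exact: esym (tau_op_square _ _ _ _ _).
  apply: etrans (act_comp (act_tau _ _ _) (act_tau _ _ _)) _; apply: esym.
  apply: etrans (act_poly _ _ _) _; rewrite Seq_act_reflK; congr pol_in.
  rewrite /tau_at !tnth_Seq_act /simple_refl tpermL tpermR.
  by apply: esym; exact: tau_op_square_neq.
- move=> t k i it it1 Pt.
  have E f : act (gen_tau F t * gen_x F k - gen_x F (refl t k) * gen_tau F t) (pol_in i f)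
    = pol_in (Seq_act (refl t) i)
        ((if (k == pos t) && (it == it1) then - subst2 (P it) 'X_(pos t) 'X_(posS t)
          else if (k == posS t) && (it == it1)
               then subst2 (P it) 'X_(pos t) 'X_(posS t) else 0) * f).
    rewrite free_actB -(tau_op_mulX K prec) linearB /=; congr (_ - _).
      exact: act_comp (act_x k i f) (act_tau _ _ _).
    exact: act_comp (act_tau t i f) (act_x _ _ _).
  case: ifP E => [/andP[_ /eqP eit] E|_]; last case: ifP => [/andP[_ /eqP eit] E|_ E].
  + apply: act_right_idem => f; rewrite E (Seq_act_refl_id eit) free_actN act_poly.
    by rewrite mulNr linearN.
  + by apply: act_right_idem => f; rewrite E (Seq_act_refl_id eit) act_poly.
  (* The right-hand side 0 is read as [0 * gen_e F i], so that [act_right_idem] applies. *)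
  + move=> v; apply: etrans (act_right_idem (b := 0) _ v) _; last by rewrite mul0r.
    by move=> f; rewrite E mul0r linear0 free_act0.
- move=> t t1 i tt1 a b c ia ib ic.
  have E f : act (gen_tau F t1 * gen_tau F t * gen_tau F t1
                  - gen_tau F t * gen_tau F t1 * gen_tau F t) (pol_in i f) = _ :=
    etrans (act_braid i f tt1) (congr1 _ (tau_op_braid K hprec tt1 _ _ _ f)).
  rewrite -/a -/b -/c -/ia -/ib -/ic in E.
  case: ifP E => [/andP[/eqP iac _] E|_]; last case: ifP => [/andP[/eqP iab /eqP ibc] E|_ E].
  + apply: act_right_idem => f; apply: etrans (E f) _.
    by rewrite Seq_act_braid_id //; apply: esym; exact: act_poly.
  + have t1b : pos t1 = b by exact/val_inj.
    have ibc' : tnth i (pos t1) = tnth i (posS t1) by rewrite t1b.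
    move=> v; rewrite -[X in act _ v = act X v]mulrDl; apply: act_right_idem => f.
    apply: etrans (E f) _.
    rewrite Seq_act_braid_id //; last exact: etrans iab ibc.
    rewrite free_actD linearD /=; congr (_ + _); apply: esym.
      apply: etrans (act_comp (act_tau _ _ _) (act_poly _ _ _)) _.
      by rewrite Seq_act_refl_id.
    apply: etrans (act_comp (act_tau _ _ _) (act_poly _ _ _)) _.
    rewrite (Seq_act_refl_id ibc') /tau_at t1b.
    by [].
  + move=> v; apply: etrans (act_right_idem (b := 0) _ v) _; last by rewrite mul0r.
    by move=> f; rewrite free_act0; apply: etrans (E f) _; exact: linear0.
Qed.

Definition pol_rep : klr K alpha -> Pol -> Pol := presented_act gen_act.

Lemma pol_rep_is_representation : is_representation pol_rep.
Proof.
split; first exact: presented_act_linear.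
- by move=> v; exact: presented_act_linearl act_rel v.
- exact: presented_act1 act_rel.
- exact: presented_actM act_rel.
Qed.

Lemma pol_rep_action : pol_action prec pol_rep.
Proof.
split.
- move=> j i f; apply: etrans (presented_actE act_rel _ _) _.
  by case: (eqVneq i j) => [->|ij]; [exact: act_e | exact: act_e_neq].
- by move=> k i f; apply: etrans (presented_actE act_rel _ _) _; exact: act_x.
- by move=> t i f; apply: etrans (presented_actE act_rel _ _) _; exact: act_tau.
Qed.

End PolRep.

(** * Spanning *)

Section LinearSpan.

Variables (F : fieldType) (V : lmodType F).

Inductive lspan (S : V -> Prop) : V -> Prop :=
| LspanGen v of S v : lspan S v
| LspanZero : lspan S 0
| LspanLin c u v of lspan S u & lspan S v : lspan S (c *: u + v).

Lemma lspanZ S c u : lspan S u -> lspan S (c *: u).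
Proof. by move=> Su; rewrite -[_ *: _]addr0; apply: LspanLin => //; exact: LspanZero. Qed.

Lemma lspanD S u v : lspan S u -> lspan S v -> lspan S (u + v).
Proof. by move=> Su Sv; rewrite -[u]scale1r; exact: LspanLin. Qed.

Lemma lspanN S u : lspan S u -> lspan S (- u).
Proof. by rewrite -scaleN1r; exact: lspanZ. Qed.

Lemma lspan_sum S J (r : seq J) (P : pred J) (f : J -> V) :
  (forall j, P j -> lspan S (f j)) -> lspan S (\sum_(j <- r | P j) f j).
Proof. by move=> Sf; elim/big_ind: _ => //; [exact: LspanZero | exact: lspanD]. Qed.

Lemma lspan_bind (S T : V -> Prop) :
  (forall v, S v -> lspan T v) -> forall v, lspan S v -> lspan T v.
Proof.
move=> ST v; elim=> {v} [v /ST //||c u v _ Tu _ Tv]; first exact: LspanZero.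
exact: LspanLin.
Qed.

(** Two combinations are merged over the union of their index lists, each extended by zero outside
    its own list. *)
Lemma lspan_family (J : eqType) (B : pred J) (b : J -> V) v :
  lspan (fun u => exists2 k, B k & u = b k) v ->
  exists (s : seq J) (c : J -> F), [/\ uniq s, all B s & v = \sum_(k <- s) c k *: b k].
Proof.
elim=> {v} [_ [k Bk ->]||a u v _ [s [c [us sB ->]]] _ [s' [c' [us' sB' ->]]]].
- by exists [:: k], (fun _ => 1); rewrite /= Bk big_seq1 scale1r.
- by exists [::], (fun _ => 0); rewrite big_nil.
exists (undup (s ++ s')),
  (fun k => (if k \in s then a * c k else 0) + (if k \in s' then c' k else 0)).
have sub (t : seq J) (f : J -> F) : uniq t -> {subset t <= s ++ s'} ->
    \sum_(k <- t) f k *: b k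
    = \sum_(k <- undup (s ++ s')) (if k \in t then f k else 0) *: b k.
  move=> ut ts; rewrite [RHS](eq_bigr (fun k => if k \in t then f k *: b k else 0)).
    2: by move=> k _; case: ifP => // _; rewrite scale0r.
  rewrite -big_mkcond.
  rewrite -big_filter; apply: perm_big; apply: uniq_perm => //.
    by rewrite filter_uniq ?undup_uniq.
  move=> k; rewrite mem_filter mem_undup.
  by case kt : (k \in t); rewrite //= ts.
split; first exact: undup_uniq.
- by apply/allP => k; rewrite mem_undup mem_cat => /orP[/(allP sB)|/(allP sB')].
rewrite scaler_sumr (eq_bigr (fun k => (a * c k) *: b k)); last by move=> k _; rewrite scalerA.
rewrite (sub s (fun k => a * c k)) ?(sub s' c') // -?big_split //=; last 2 first.
- by move=> k ks; rewrite mem_cat ks orbT.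
- by move=> k ks; rewrite mem_cat ks.
by apply: eq_bigr => k _; rewrite scalerDl.
Qed.

End LinearSpan.

Lemma commr_prod_exp (R : pzRingType) (J : eqType) (h : J -> R) (r : seq J) (m : J -> nat) k :
  (forall i j, h i * h j = h j * h i) -> uniq r -> k \in r ->
  h k * \prod_(j <- r) h j ^+ m j = \prod_(j <- r) h j ^+ ((k == j) + m j).
Proof.
move=> hC; elim: r => // j r IH /= /andP[jr ur]; rewrite inE !big_cons.
case: (eqVneq k j) => [->|kj] /= kr.
  rewrite add1n exprS mulrA; congr (_ * _); apply: eq_big_seq => i ir.
  by case: eqP ir jr => // -> ->.
rewrite add0n -IH // !mulrA; congr (_ * _).
exact: (commrX (m j) (hC k j)).
Qed.

Section IdempotentRelations.

Variable R : pzRingType.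
Implicit Types (a b c e p q r u v w x y : R).

(** The KLR relations come multiplied on the right by an idempotent; this lemma and the next two
    apply them to an element [w] fixed by that idempotent. *)
Lemma mulr_idem_comm a x y p e w :
  a * x * e = y * a * e + p * e -> e * w = w -> y * (a * w) = a * (x * w) - p * w.
Proof. by move=> E Ew; rewrite -Ew !mulrA E mulrDl addrK. Qed.

Lemma mulr_idem_square a p q e w :
  a * a * e = p * a * e + q * e -> e * w = w -> a * (a * w) = p * (a * w) + q * w.
Proof. by move=> E Ew; rewrite -Ew !mulrA E mulrDl. Qed.

Lemma mulr_idem_braid a b p q r e w :
  b * a * b * e = a * b * a * e + (p * a * e + q * b * e + r * e) -> e * w = w ->
  b * (a * (b * w)) - a * (b * (a * w)) = p * (a * w) + q * (b * w) + r * w.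
Proof. by move=> E Ew; rewrite -Ew !mulrA E !mulrDl addrC addKr. Qed.

End IdempotentRelations.

(** * Straightening tau words in the KLR algebra *)

Section KLRRelations.

Variables (F : fieldType) (I : countType) (D : cartan_datum I).
Variables (K : klr_datum F D) (alpha : {mset I}).

Local Notation d := (height alpha).
Local Notation R := (klr K alpha).
Local Notation pi := (@klr_pi F I D K alpha).
Local Notation e := (@klr_e F I D K alpha).
Local Notation x := (@klr_x F I D K alpha).
Local Notation tau := (@klr_tau F I D K alpha).
Local Notation word := (@klr_tau_word F I D K alpha).
Local Notation xmon := (@klr_x_mon F I D K alpha).
Implicit Types (i j : Seq alpha) (s t : 'I_d.-1) (k : 'I_d) (a b : seq 'I_d.-1).

Definition klr_poly (g : {mpoly F[d]}) : R := pi (gen_poly g).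

HB.instance Definition _ :=
  GRing.RMorphism.copy pi (@presented_pi F (klr_gen alpha) (@klr_rel F I D K alpha)).
HB.instance Definition _ :=
  GRing.Linear.copy pi (@presented_pi F (klr_gen alpha) (@klr_rel F I D K alpha)).

Lemma klr_piM (a b : free_alg F (klr_gen alpha)) : pi (a * b) = pi a * pi b.
Proof. exact: rmorphM. Qed.

Lemma klr_piZ c (a : free_alg F (klr_gen alpha)) : pi (c *: a) = c *: pi a.
Proof. exact: presented_pi_scalable. Qed.

Lemma klr_piM3 (a b c : free_alg F (klr_gen alpha)) : pi (a * b * c) = pi a * pi b * pi c.
Proof. by rewrite klr_piM klr_piM. Qed.

Lemma klr_piBM (a b c : free_alg F (klr_gen alpha)) :
  pi ((a - b) * c) = pi a * pi c - pi b * pi c.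
Proof. by rewrite klr_piM rmorphB mulrBl. Qed.

Lemma klr_pi_rel (a b : free_alg F (klr_gen alpha)) : klr_rel K a b -> pi a = pi b.
Proof. exact: presented_rel. Qed.

Lemma klr_eM i j : e i * e j = if i == j then e i else 0.
Proof.
apply: etrans (esym (klr_piM _ _)) _; rewrite (klr_pi_rel (klr_idem K i j)).
by case: eqP => // _; rewrite rmorph0.
Qed.

Lemma klr_e_sum : \sum_(i : Seq alpha) e i = 1 :> R.
Proof.
apply: etrans (esym (rmorph_sum pi _ _ _)) _.
by apply: etrans (klr_pi_rel (@klr_unit F I D K alpha)) _; exact: rmorph1.
Qed.

Lemma klr_xE k i : x k * e i = e i * x k.
Proof.
exact: etrans (esym (klr_piM _ _)) (etrans (klr_pi_rel (klr_xe K k i)) (klr_piM _ _)).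
Qed.

Lemma klr_xC (k l : 'I_d) : x k * x l = x l * x k.
Proof.
exact: etrans (esym (klr_piM _ _)) (etrans (klr_pi_rel (klr_xx K k l)) (klr_piM _ _)).
Qed.

Lemma klr_tauE t i : tau t * e i = e (Seq_act (simple_refl t) i) * tau t.
Proof.
exact: etrans (esym (klr_piM _ _)) (etrans (klr_pi_rel (klr_taue K t i)) (klr_piM _ _)).
Qed.

Lemma klr_tauC s t : (s.+1 < t)%N || (t.+1 < s)%N -> tau t * tau s = tau s * tau t.
Proof.
move=> st.
exact: etrans (esym (klr_piM _ _)) (etrans (klr_pi_rel (klr_tautau K st)) (klr_piM _ _)).
Qed.

Lemma gen_poly0 : gen_poly 0 = 0 :> free_alg F (klr_gen alpha).
Proof. by rewrite /gen_poly /mmap msupp0 big_nil. Qed.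

Lemma gen_polyN (g : {mpoly F[d]}) : gen_poly (- g) = - gen_poly g.
Proof.
rewrite /gen_poly /mmap -sumrN (perm_big _ (msuppN g)) /=; apply: eq_bigr => m _.
by rewrite mcoeffN scaleNr mulNr.
Qed.

Lemma klr_poly0 : klr_poly 0 = 0.
Proof. by rewrite /klr_poly gen_poly0 rmorph0. Qed.

(** Spanning uses only the shape of the relation, so both colour cases are covered by existential
    polynomial coefficients. *)
Lemma klr_tau_square t i : exists p q,
  tau t * tau t * e i = klr_poly p * tau t * e i + klr_poly q * e i.
Proof.
have L : tau t * tau t * e i = pi (gen_tau F t ^+ 2 * gen_e F i).
  exact: esym (klr_piM3 _ _ _).
rewrite {}L (klr_pi_rel (klr_tau2 K t i)); case: ifP => _.
  exists (demazure t (subst2 (Ppoly K (tnth i (pos t))) 'X_(pos t) 'X_(posS t))), 0.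
  by rewrite klr_poly0 mul0r addr0; exact: klr_piM3.
exists 0, (subst2 (Qpoly K (tnth i (pos t)) (tnth i (posS t))) 'X_(pos t) 'X_(posS t)).
by rewrite klr_poly0 !mul0r add0r; exact: klr_piM.
Qed.

Lemma klr_tau_x t k i : exists p,
  tau t * x k * e i = x (simple_refl t k) * tau t * e i + klr_poly p * e i.
Proof.
have L : tau t * x k * e i - x (simple_refl t k) * tau t * e i =
    pi ((gen_tau F t * gen_x F k - gen_x F (simple_refl t k) * gen_tau F t) * gen_e F i).
  apply: esym; apply: etrans (klr_piBM _ _ _) _.
  by congr (_ * _ - _ * _); exact: klr_piM.
set P := subst2 (Ppoly K (tnth i (pos t))) 'X_(pos t) 'X_(posS t).
suff [p Ep] : exists p, tau t * x k * e i - x (simple_refl t k) * tau t * e i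
    = klr_poly p * e i.
  by exists p; rewrite -Ep addrC subrK.
rewrite {}L (klr_pi_rel (klr_taux K t k i)); case: ifP => _.
  by exists (- P); rewrite /klr_poly gen_polyN; exact: klr_piM.
case: ifP => _; first by exists P; exact: klr_piM.
by exists 0; rewrite klr_poly0 mul0r; exact: rmorph0.
Qed.

Lemma klr_tau_braid t t1 i : t1 = t.+1 :> nat -> exists p q r,
  tau t1 * tau t * tau t1 * e i = tau t * tau t1 * tau t * e i
  + (klr_poly p * tau t * e i + klr_poly q * tau t1 * e i + klr_poly r * e i).
Proof.
move=> tt1.
have L : tau t1 * tau t * tau t1 * e i - tau t * tau t1 * tau t * e i =
    pi ((gen_tau F t1 * gen_tau F t * gen_tau F t1
         - gen_tau F t * gen_tau F t1 * gen_tau F t) * gen_e F i).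
  apply: esym; apply: etrans (klr_piBM _ _ _) _.
  by congr (_ * _ - _ * _); exact: klr_piM3.
suff [p [q [r E]]] : exists p q r,
    tau t1 * tau t * tau t1 * e i - tau t * tau t1 * tau t * e i =
    klr_poly p * tau t * e i + klr_poly q * tau t1 * e i + klr_poly r * e i.
  by exists p, q, r; rewrite -E addrC subrK.
rewrite {}L (klr_pi_rel (klr_braid K i tt1)); case: ifP => _; last case: ifP => _.
- exists 0, 0; eexists; rewrite klr_poly0 !mul0r !add0r; exact: klr_piM.
- do 2 eexists; exists 0; rewrite klr_poly0 mul0r addr0.
  by apply: etrans (rmorphD pi _ _) _; congr (_ + _); exact: klr_piM3.
- by exists 0, 0, 0; rewrite klr_poly0 !mul0r !addr0; exact: rmorph0.
Qed.

Lemma klr_x_monU k m : x k * xmon m = xmon (U_(k) + m)%MM.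
Proof.
rewrite /klr_x_mon (@commr_prod_exp R _ x _ (fun l => m l) k klr_xC);
  rewrite ?index_enum_uniq ?mem_index_enum //.
by apply: eq_bigr => j _; rewrite mnmDE mnm1E.
Qed.

Lemma klr_xmonE m i : xmon m * e i = e i * xmon m.
Proof.
rewrite /klr_x_mon; elim/big_rec: _ => [|k u _ IH]; first by rewrite mul1r mulr1.
rewrite -mulrA IH !mulrA; congr (_ * _); apply: esym.
by apply: commrX; rewrite /GRing.comm klr_xE.
Qed.

Lemma klr_wordE a i : word a * e i = e (Seq_act (expr_prod a) i) * word a.
Proof.
rewrite /klr_tau_word; elim: a => [|t a IH].
  rewrite !big_nil mul1r mulr1; congr e; apply/val_inj/eq_from_tnth => k.
  by rewrite /expr_prod big_nil /= tnth_mktuple perm1.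
by rewrite !big_cons -mulrA IH mulrA klr_tauE -Seq_actM -expr_prod_cons mulrA.
Qed.

Lemma klr_word_cat a b : word (a ++ b) = word a * word b.
Proof. exact: big_cat. Qed.

Lemma klr_word_cons t a : word (t :: a) = tau t * word a.
Proof. exact: big_cons. Qed.

Lemma klr_polyE g : klr_poly g = \sum_(m <- msupp g) g@_m *: xmon m.
Proof.
apply: etrans (rmorph_sum pi _ _ _) _; apply: eq_bigr => m _.
apply: etrans (congr1 pi (mulr_algl _ _)) _; apply: etrans (klr_piZ _ _) _.
congr (_ *: _); apply: etrans (rmorph_prod pi _ _ _) _; apply: eq_bigr => k _.
exact: rmorphXn.
Qed.

Lemma klr_scalerAl (c : F) (u v : R) : c *: (u * v) = (c *: u) * v.
Proof. exact: presented_scalerAl. Qed.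

Lemma klr_scalerAr (c : F) (u v : R) : c *: (u * v) = u * (c *: v).
Proof. exact: presented_scalerAr. Qed.

Lemma lspan_mull (S T : R -> Prop) u :
  (forall v, S v -> lspan T (u * v)) -> forall v, lspan S v -> lspan T (u * v).
Proof.
move=> ST v; elim=> {v} [v /ST //||c v w _ Tv _ Tw].
  by rewrite mulr0; exact: LspanZero.
by rewrite mulrDr -klr_scalerAr; exact: LspanLin.
Qed.

Definition word_elt a m i : R := word a * xmon m * e i.

Lemma word_elt_nil m i : word_elt [::] m i = xmon m * e i.
Proof. by rewrite /word_elt /klr_tau_word big_nil mul1r. Qed.

Lemma word_elt_nil0 i : word_elt [::] 0%MM i = e i.
Proof.
rewrite word_elt_nil /klr_x_mon big1 ?mul1r // => k _.
by rewrite mnm0E expr0.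
Qed.

Lemma word_elt_cons t a m i : word_elt (t :: a) m i = tau t * word_elt a m i.
Proof. by rewrite /word_elt klr_word_cons -!mulrA. Qed.

Lemma word_elt_cat a b m i : word_elt (a ++ b) m i = word a * word_elt b m i.
Proof. by rewrite /word_elt klr_word_cat -!mulrA. Qed.

Lemma e_word_elt j a m i :
  e j * word_elt a m i = if j == Seq_act (expr_prod a) i then word_elt a m i else 0.
Proof.
rewrite /word_elt -mulrA klr_xmonE !mulrA -(mulrA (e j)) klr_wordE mulrA klr_eM.
by case: eqP => [->//|_]; rewrite ?mul0r.
Qed.

Lemma word_elt_idem a m i : e (Seq_act (expr_prod a) i) * word_elt a m i = word_elt a m i.
Proof. by rewrite e_word_elt eqxx. Qed.

(** The bound is strict, so that corrections to a word of length [l] fall into [short l] and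
    [short 0] is zero. *)
Definition short l : R -> Prop :=
  lspan (fun v => exists a m i, (size a < l)%N /\ v = word_elt a m i).

Lemma short_word a m i l : (size a < l)%N -> short l (word_elt a m i).
Proof. by move=> al; apply: LspanGen; exists a, m, i. Qed.

Lemma short_mono l l' v : (l <= l')%N -> short l v -> short l' v.
Proof.
move=> ll'; apply: lspan_bind => _ [a [m [i [al ->]]]].
exact: short_word (leq_trans al ll').
Qed.

Lemma short_tau l t v : short l v -> short l.+1 (tau t * v).
Proof.
apply: lspan_mull => _ [a [m [i [al ->]]]].
by rewrite -word_elt_cons; apply: short_word.
Qed.

Lemma short_cat l a v : short l v -> short (size a + l) (word a * v).
Proof.
move=> lv; elim: a => [|t a IH]; first by rewrite /klr_tau_word big_nil mul1r.
by rewrite klr_word_cons -mulrA; exact: short_tau.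
Qed.

Lemma short_poly l g v :
  (forall k u, short l u -> short l (x k * u)) -> short l v -> short l (klr_poly g * v).
Proof.
move=> lx lv; rewrite klr_polyE mulr_suml; apply: lspan_sum => m _.
rewrite -klr_scalerAl; apply: lspanZ; rewrite /klr_x_mon.
move: v lv; elim/big_ind: _ => [v lv|u w IHu IHw v lv|k _ v lv].
- by rewrite mul1r.
- by rewrite -mulrA; exact: IHu _ (IHw _ lv).
- elim: (m k) => [|n IH]; first by rewrite mul1r.
  by rewrite exprS -mulrA; exact: lx.
Qed.

(** Moving [x k] past [tau t] permutes its index, at the cost of a polynomial times a word with one
    letter fewer. *)
Lemma short_x l k v : short l v -> short l (x k * v).
Proof.
elim: l k v => [|l IH] k v.
  by apply: lspan_mull => w [a [m [i []]]].
apply: lspan_mull => _ [[|t a] [m [i [al ->]]]].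
  rewrite word_elt_nil mulrA klr_x_monU -word_elt_nil.
  exact: short_word.
rewrite word_elt_cons; set w := word_elt a m i.
have lw : short l w by exact: short_word.
have [p] := klr_tau_x t (simple_refl t k) (Seq_act (expr_prod a) i).
rewrite tpermK => E.
have Ew : e (Seq_act (expr_prod a) i) * w = w by exact: word_elt_idem.
have -> : x k * (tau t * w) = tau t * (x (simple_refl t k) * w) - klr_poly p * w.
  exact: mulr_idem_comm E Ew.
apply: lspanD; first by apply: short_tau; exact: IH.
apply: lspanN; apply: (@short_mono l) => //.
exact: short_poly.
Qed.

Lemma short_poly_mul l g v : short l v -> short l (klr_poly g * v).
Proof. by apply: short_poly => k u; exact: short_x. Qed.

(** Commutation is exact; in the error of a braid move at most one of the three letters survives. *)
Lemma word_elt_braid a b m i l : braid_eq a b -> (size a <= l)%N ->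
  short l (word_elt a m i - word_elt b m i).
Proof.
elim=> {a b} [a|a b ab IH|a b c ab IHab bc IHbc|a b s t st|a b s t st] al.
- by rewrite subrr; exact: LspanZero.
- by rewrite -opprB; apply: lspanN; apply: IH; rewrite (braid_eq_size ab).
- rewrite -(subrK (word_elt b m i) (word_elt a m i)) -addrA; apply: lspanD.
    exact: IHab.
  by apply: IHbc; rewrite -(braid_eq_size ab).
- rewrite !word_elt_cat !word_elt_cons !(mulrA (tau _) (tau _)) klr_tauC ?subrr //.
    exact: LspanZero.
  by rewrite orbC.
rewrite !word_elt_cat !word_elt_cons; set w := word_elt b m i.
rewrite -mulrBr -opprB mulrN; apply: lspanN.
set j := Seq_act (expr_prod b) i.
have Ew : e j * w = w by exact: word_elt_idem.
have [p [q [r E]]] := klr_tau_braid j st.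
have -> : tau t * (tau s * (tau t * w)) - tau s * (tau t * (tau s * w)) =
    klr_poly p * (tau s * w) + klr_poly q * (tau t * w) + klr_poly r * w.
  exact: mulr_idem_braid E Ew.
have w1 : short (size b).+1 w by exact: short_word.
have w2 : short (size b).+2 (klr_poly p * (tau s * w) + klr_poly q * (tau t * w) + klr_poly r * w).
  apply: lspanD; first by apply: lspanD; apply: short_poly_mul; exact: short_tau.
  by apply: short_poly_mul; exact: short_mono w1.
apply: short_mono (short_cat a w2).
by move: al; rewrite size_cat /=; lia.
Qed.

Lemma word_elt_square a m i l : has_square a -> (size a <= l)%N -> short l (word_elt a m i).
Proof.
move=> [b [s [c E]]] al.
rewrite -(subrK (word_elt (b ++ [:: s, s & c]) m i) (word_elt a m i)).
apply: lspanD; first exact: word_elt_braid.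
rewrite word_elt_cat !word_elt_cons; set w := word_elt c m i.
have Ew := word_elt_idem c m i; rewrite -/w in Ew.
have [p [q Epq]] := klr_tau_square s (Seq_act (expr_prod c) i).
have -> : tau s * (tau s * w) = klr_poly p * (tau s * w) + klr_poly q * w.
  exact: mulr_idem_square Epq Ew.
have w1 : short (size c).+1 w by exact: short_word.
have w2 : short (size c).+2 (klr_poly p * (tau s * w) + klr_poly q * w).
  apply: lspanD; first by apply: short_poly_mul; exact: short_tau.
  by apply: short_poly_mul; exact: short_mono w1.
apply: short_mono (short_cat b w2).
by move: al; rewrite (braid_eq_size E) size_cat /=; lia.
Qed.

Lemma klr_short (u : R) : exists l, short l u.
Proof.
apply: (presented_ind (S := fun u : R => exists l, short l u)) u.
- by exists 0%N; exact: LspanZero.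
- move=> c u v [l lu] [l' lv]; exists (maxn l l'); apply: LspanLin.
    by apply: short_mono lu; exact: leq_maxl.
  by apply: short_mono lv; exact: leq_maxr.
- exists 1%N; rewrite -[X in short _ X]klr_e_sum; apply: lspan_sum => i _.
  by rewrite -word_elt_nil0; exact: short_word.
case=> [j|[k|t]] u [l lu].
- exists l; move: lu; apply: lspan_mull => _ [a [m [i [al ->]]]].
  have -> : presented_pi (@klr_rel F I D K alpha) (free_gen F (inl j)) = e j by [].
  rewrite e_word_elt; case: ifP => _; [exact: short_word | exact: LspanZero].
- by exists l; exact: short_x.
- by exists l.+1; exact: short_tau.
Qed.

Section ReducedSpan.

Variable red : 'S_d -> seq 'I_d.-1.
Hypothesis hred : forall w, reduced_expr w (red w).

Lemma klr_reduced_span (u : R) :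
  lspan (fun v => exists w m i, v = word_elt (red w) m i) u.
Proof.
have [l lu] := klr_short u; elim: l u lu => [|l IH] u.
  by apply: lspan_bind => w [a [m [i []]]].
apply: lspan_bind => _ [a [m [i [al ->]]]].
case: (braid_eq_reduced (hred (expr_prod a))) => [E|sq].
  rewrite -(subrK (word_elt (red (expr_prod a)) m i) (word_elt a m i)).
  apply: lspanD; first by apply: IH; exact: word_elt_braid.
  by apply: LspanGen; exists (expr_prod a), m, i.
by apply: IH; exact: word_elt_square.
Qed.

End ReducedSpan.

End KLRRelations.

(** * Linear independence and faithfulness *)

Section SubstitutionInjective.

Variable F : fieldType.

Lemma subst2_id (p : {mpoly F[2]}) : subst2 p 'X_ord0 'X_ord_max = p.
Proof.
rewrite -[RHS]comp_mpoly_id /subst2; congr (p \mPo _); apply: eq_from_tnth => i.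
rewrite tnth_mktuple (tnth_nth 0).
by case: i => [[|[|//]]] hi /=; congr 'X_[U_(_)]; exact/val_inj.
Qed.

(** The substitution has a left inverse [psi], which sends ['X_i] to the first variable and all
    others to the second. *)
Lemma subst2_neq0 n (i j : 'I_n) (p : {mpoly F[2]}) :
  i != j -> p != 0 -> subst2 p 'X_i 'X_j != 0 :> {mpoly F[n]}.
Proof.
move=> ij; apply: contra => /eqP E.
pose psi := [tuple (if k == i then 'X_ord0 else 'X_ord_max) : {mpoly F[2]} | k < n].
have psiC c : comp_mpoly psi c%:MP = c%:MP by exact: comp_mpolyC.
have := rmorph_subst2 (phi := comp_mpoly psi) p 'X_i 'X_j psiC.
rewrite E /= comp_mpoly0 !comp_mpolyXU -!tnth_nth !tnth_mktuple eqxx eq_sym (negPf ij).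
by rewrite eq_sym subst2_id => <-.
Qed.

Variables (I : countType) (D : cartan_datum I) (K : klr_datum F D) (prec : rel I).

Lemma Ppoly_neq0 a : Ppoly K a != 0.
Proof. by apply: contraNneq (Ppoly_leadl K a) => ->; rewrite mcoeff0. Qed.

Lemma Qpoly_neq0 a b : a != b -> Qpoly K a b != 0.
Proof. by move=> /(Qpoly_lead K); apply: contraNneq => ->; rewrite mcoeff0. Qed.

(** The nonzero leading coefficients of P and Q enter here; they keep the top term of
    [word_at_expansion] alive. *)
Lemma tauA_neq0 d (i j : 'I_d) a b : i != j ->
  tauA K prec a b 'X_i 'X_j != 0 :> {mpoly F[d]}.
Proof.
move=> ij; rewrite /tauA; case: (eqVneq a b) => [_|ab].
  by rewrite subst2_neq0 // Ppoly_neq0.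
case: ifP => _; last exact: mpolyX_neq.
by rewrite mulf_neq0 ?mpolyX_neq // subst2_neq0 // Qpoly_neq0 // eq_sym.
Qed.

End SubstitutionInjective.

Lemma clear_denominators (R : comPzRingType) (del den den' A B T g g' : R) :
  del * T = A * g' + B * g ->
  del * den * den' * T = A * den * (den' * g') + B * den' * (den * g).
Proof.
move=> E; have -> : del * den * den' * T = den * den' * (del * T) by ring.
by rewrite E; ring.
Qed.

(** * Tau words as combinations of permutation automorphisms *)

Section Independence.

Variables (F : fieldType) (I : countType) (D : cartan_datum I).
Variables (K : klr_datum F D) (prec : rel I).
Hypothesis hprec : strict_total_order prec.
Variable alpha : {mset I}.

Local Notation d := (height alpha).

Variable red : 'S_d -> seq 'I_d.-1.
Hypothesis hred : forall w, reduced_expr w (red w).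

Local Notation R := (klr K alpha).
Local Notation len w := (size (red w)).
Local Notation rho := (@pol_rep F I D K prec alpha).
Implicit Types (i j : Seq alpha) (f g : {mpoly F[d]}) (t : 'I_d.-1) (w v : 'S_d).

Lemma msym_eq0 w f : (msym w f == 0) = (f == 0).
Proof. by rewrite raddf_eq0 //; exact: inj_msym. Qed.

Lemma red_prod w : expr_prod (red w) = w.
Proof. by case: (hred w). Qed.

Lemma len_expr_prod a : (len (expr_prod a) <= size a)%N.
Proof. by case: (hred (expr_prod a)) => _; exact. Qed.

Lemma len_refl t w : (len (simple_refl t * w)%g <= (len w).+1)%N.
Proof. by have := len_expr_prod (t :: red w); rewrite expr_prod_cons red_prod. Qed.

Fixpoint word_at (a : seq 'I_d.-1) i f : {mpoly F[d]} :=
  if a is t :: a' then tau_at K prec t (Seq_act (expr_prod a') i) (word_at a' i f) else f.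

Lemma pol_rep_word a i f :
  rho (klr_tau_word K a) (pol_in i f) = pol_in (Seq_act (expr_prod a) i) (word_at a i f).
Proof.
have [_ _ rho1 rhoM] := pol_rep_is_representation K hprec alpha.
have [_ _ rho_tau] := pol_rep_action K hprec alpha.
elim: a => [|t a IH].
  by rewrite /klr_tau_word big_nil rho1 /= /expr_prod big_nil Seq_act1.
rewrite klr_word_cons rhoM IH rho_tau expr_prod_cons Seq_actM.
by [].
Qed.

Lemma pol_rep_xmon m i f :
  rho (klr_x_mon K m) (pol_in i f) = pol_in i ('X_[m] * f).
Proof.
have [_ _ rho1 rhoM] := pol_rep_is_representation K hprec alpha.
have [_ rho_x _] := pol_rep_action K hprec alpha.
rewrite mpolyXE_id /klr_x_mon; elim/big_rec2: _ => [|k p u _ IH].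
  by rewrite rho1 mul1r.
rewrite rhoM IH -mulrA; elim: (m k) => [|n IHn]; first by rewrite !expr0 mul1r rho1.
by rewrite !exprS rhoM IHn rho_x mulrA.
Qed.

Lemma pol_rep_word_elt a m i f :
  rho (word_elt K a m i) (pol_in i f)
  = pol_in (Seq_act (expr_prod a) i) (word_at a i ('X_[m] * f)).
Proof.
have [_ _ _ rhoM] := pol_rep_is_representation K hprec alpha.
have [rho_e _ _] := pol_rep_action K hprec alpha.
by rewrite !rhoM rho_e eqxx pol_rep_xmon pol_rep_word.
Qed.

(* Triangularity for the length.  The inverses are there because [msym] is a *)
(* right action: msym (v * w) = msym w \o msym v. *)
Lemma word_at_expansion a i : exists (den : {mpoly F[d]}) (c : 'S_d -> {mpoly F[d]}),
  [/\ den != 0,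
      forall f, den * word_at a i f = \sum_v c v * msym v^-1 f,
      forall v, c v != 0 ->
        (len v <= size a)%N /\ (len v = size a -> v = expr_prod a)
    & len (expr_prod a) = size a -> c (expr_prod a) != 0].
Proof.
elim: a => [|t a [den [c [den0 cE c_supp c_lead]]]] /=.
  exists 1, (fun v => if v == 1%g then 1 else 0).
  have E1 : expr_prod [::] = 1%g :> 'S_d by rewrite /expr_prod big_nil.
  split=> [|f|v|]; first exact: oner_neq0.
  - rewrite (bigD1 1%g) //= eqxx invg1 msym1m !mul1r big1 ?addr0 // => v /negPf ->.
    by rewrite mul0r.
  - have [->|_] := eqVneq v 1%g; last by rewrite eqxx.
    by move=> _; split=> //; rewrite -E1; exact: len_expr_prod.
  - by rewrite E1 eqxx oner_neq0.
set j := Seq_act (expr_prod a) i; set r := simple_refl t.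
set A := tauA K prec (tnth j (pos t)) (tnth j (posS t)) 'X_(pos t) 'X_(posS t).
set B : {mpoly F[d]} := tauB K (tnth j (pos t)) (tnth j (posS t)) 'X_(pos t) 'X_(posS t).
have rr v : (r * (r * v))%g = v by rewrite mulgA simple_reflK mul1g.
have den0' : msym r den != 0 by rewrite msym_eq0.
(* The permutation [v] is reached from [r * v] through the reflected term and from [v] itself
   through the other one. *)
pose c' v := A * den * msym r (c (r * v)%g) + B * msym r den * c v.
exists (root_diff F t * den * msym r den), c'; split.
- by rewrite !mulf_neq0 // root_diff_neq0.
- move=> f; set g := word_at a i f.
  have E1 : msym r den * msym r g = \sum_v msym r (c (r * v)%g) * msym v^-1 f.
    rewrite -rmorphM cE rmorph_sum (reindex_inj (mulgI r)) /=; apply: eq_bigr => v _.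
    apply: etrans (rmorphM (msym r) _ _) _; congr (_ * _).
    apply: etrans (esym (msymMm _ _ _)) _; congr (msym _ f).
    by rewrite invMg mulgKV.
  have E2 := tau_opE K prec t (tnth j (pos t)) (tnth j (posS t)) g.
  apply: etrans (clear_denominators _ _ E2) _; rewrite -/A -/B.
  rewrite [refl_poly t g]/(msym r g) E1 cE [X in X + _]mulr_sumr [X in _ + X]mulr_sumr.
  rewrite -big_split; apply: eq_bigr => v _ /=.
  by rewrite /c' mulrDl !mulrA.
- have c0 : c' = fun v => c' v by [].
  move=> v; rewrite /c'; have [->|cv _] := eqVneq (c v) 0; last first.
    have [cl _] := c_supp v cv; split; first exact: leqW.
    by move=> lv; rewrite lv ltnn in cl.
  rewrite mulr0 addr0; have [->|crv _] := eqVneq (c (r * v)%g) 0.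
    by rewrite rmorph0 mulr0 eqxx.
  have [cl cl'] := c_supp _ crv; have lv := len_refl t (r * v)%g; rewrite rr in lv.
  split; first by apply: leq_trans lv _.
  move=> El; rewrite El in lv; rewrite expr_prod_cons -[LHS]rr; congr (_ * _)%g.
  by apply: cl'; apply/eqP; rewrite eqn_leq cl -ltnS.
- rewrite expr_prod_cons => El; have Ela : len (expr_prod a) = size a.
    by apply/eqP; rewrite eqn_leq len_expr_prod -ltnS -El len_refl.
  (* The second summand of [c'] drops out: [r * expr_prod a] is longer than [a], hence outside the
     support of [c]. *)
  rewrite /c' rr; have [->|crv] := eqVneq (c (r * expr_prod a)%g) 0; last first.
    have [cl _] := c_supp _ crv; by rewrite El ltnn in cl.
  rewrite mulr0 addr0 !mulf_neq0 ?tauA_neq0 ?pos_neq //.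
  by rewrite msym_eq0 c_lead.
Qed.

End Independence.

Lemma linear_comb (F : fieldType) (V W : lmodType F) (phi : V -> W)
    (J : Type) (s : seq J) (c : J -> F) (u : J -> V) :
  linear phi -> phi (\sum_(k <- s) c k *: u k) = \sum_(k <- s) c k *: phi (u k).
Proof.
move=> lin; elim: s => [|k s IH]; last by rewrite !big_cons lin IH.
(* The scalar -1 at zero vectors extracts [phi 0 = 0] from the one-line form of linearity. *)
have := lin (-1) 0 0; rewrite !big_nil scaler0 addr0 scaleN1r addNr.
by [].
Qed.

Lemma msym_independentV (F : fieldType) n (c : 'S_n -> {mpoly F[n]}) :
  (forall f, \sum_v c v * msym v^-1 f = 0) -> forall v, c v = 0.
Proof.
move=> sum0 v; rewrite -[v]invgK.
apply: (@msym_independent F n (index_enum _) (fun w => c w^-1)%g); last first.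
- exact: mem_index_enum.
- move=> f; rewrite -[RHS](sum0 f) [RHS](reindex_inj invg_inj) /=.
  by apply: eq_bigr => w _; rewrite invgK.
- exact: index_enum_uniq.
Qed.

(** * The basis of each corner and faithfulness *)

Section Basis.

Variables (F : fieldType) (I : countType) (D : cartan_datum I).
Variables (K : klr_datum F D) (prec : rel I).
Hypothesis hprec : strict_total_order prec.
Variable alpha : {mset I}.

Local Notation d := (height alpha).

Variable red : 'S_d -> seq 'I_d.-1.
Hypothesis hred : forall w, reduced_expr w (red w).

Local Notation R := (klr K alpha).
Local Notation len w := (size (red w)).
Local Notation rho := (@pol_rep F I D K prec alpha).
Implicit Types (i j : Seq alpha) (f g : {mpoly F[d]}) (w v : 'S_d).

Definition red_elt i (k : 'S_d * 'X_{1..d}) : R := word_elt K (red k.1) k.2 i.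

Lemma pol_rep_red_elt i k f :
  rho (red_elt i k) (pol_in i f)
  = pol_in (Seq_act k.1 i) (word_at K prec (red k.1) i ('X_[k.2] * f)).
Proof. by rewrite /red_elt (pol_rep_word_elt _ hprec) (red_prod hred). Qed.

Lemma red_elt_independent i (s : seq ('S_d * 'X_{1..d})) (c : 'S_d * 'X_{1..d} -> F) :
  uniq s -> (forall f, rho (\sum_(k <- s) c k *: red_elt i k) (pol_in i f) = 0) ->
  {in s, forall k, c k = 0}.
Proof.
move=> us act0.
have [_ rho_lin _ _] := pol_rep_is_representation K hprec alpha.
(* The component at [j] of the result separates the permutations by the sequence to which they send
   [i]. *)
have act0' j f : \sum_(k <- s | Seq_act k.1 i == j)
    c k *: word_at K prec (red k.1) i ('X_[k.2] * f) = 0.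
  have := act0 f; rewrite (linear_comb _ _ _ (rho_lin (pol_in i f))).
  move=> /(congr1 (fun u : Pol F alpha => u j)); rewrite sum_ffunE [RHS]ffunE => E.
  rewrite -[RHS]E big_mkcond; apply: eq_bigr => k _.
  rewrite pol_rep_red_elt ffunE pol_in_eval [j == _]eq_sym.
  by case: ifP => // _; rewrite scaler0.
have /choice[den /choice[C DC]] : forall w,
  exists (den : {mpoly F[d]}) (c : 'S_d -> {mpoly F[d]}),
  [/\ den != 0,
      forall f, den * word_at K prec (red w) i f = \sum_v c v * msym v^-1 f,
      forall v, c v != 0 -> (len v <= len w)%N /\ (len v = len w -> v = w)
    & c w != 0].
  move=> w; have [den [c' [den0 cE c_supp c_lead]]] := word_at_expansion K prec hred (red w) i.
  rewrite (red_prod hred) in c_supp c_lead.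
  by exists den, c'; split => //; exact: c_lead.
have [N lenN] : exists N, forall w, (len w <= N)%N.
  by exists (\max_(w : 'S_d) len w) => w; exact: (@leq_bigmax _ (fun w : 'S_d => len w)).
pose den' w := \prod_(u | u != w) den u.
have den'E w : \prod_u den u = den w * den' w by rewrite (bigD1 w).
have den'0 w : den' w != 0.
  by apply/prodf_neq0 => u _; case: (DC u).
(* Descending induction on the length of [k.1], turned into an ascending one by the bound [N]. *)
suff H n k : k \in s -> (N - len k.1 < n)%N -> c k = 0.
  by move=> k ks; exact: (H _ k ks (ltnSn _)).
elim: n k => // n IH [w0 m0] ks lk.
have c_long k : k \in s -> (len w0 < len k.1)%N -> c k = 0.
  move=> ks' lk'; apply: IH => //; move: lk lk' => /=.
  by move: (len k.1) (len w0) (lenN k.1) => p q pN; lia.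
pose T k v := den' k.1 * C k.1 v * msym v^-1 'X_[k.2].
(* Over the common denominator, the product of all [den u], the relation combines automorphisms with
   polynomial coefficients; Dedekind's theorem gives the vanishing of the one at [w0]. *)
have G0 := @msym_independentV F d
  (fun v => \sum_(k <- s | Seq_act k.1 i == Seq_act w0 i) c k *: T k v) _ w0.
have {}G0 : \sum_(k <- s | Seq_act k.1 i == Seq_act w0 i) c k *: T k w0 = 0.
  apply: G0 => f; transitivity ((\prod_u den u) * \sum_(k <- s | Seq_act k.1 i == Seq_act w0 i)
      c k *: word_at K prec (red k.1) i ('X_[k.2] * f)); last by rewrite act0' mulr0.
  transitivity (\sum_v \sum_(k <- s | Seq_act k.1 i == Seq_act w0 i)
      c k *: T k v * msym v^-1 f); first by apply: eq_bigr => v _; exact: mulr_suml.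
  rewrite exchange_big [RHS]mulr_sumr; apply: eq_bigr => k _ /=.
  rewrite (den'E k.1) -scalerAr [den _ * _]mulrC -mulrA.
  have [_ -> _ _] := DC k.1.
  rewrite mulr_sumr scaler_sumr; apply: eq_bigr => v _.
  rewrite -scalerAl /T; congr (_ *: _).
  by rewrite (rmorphM (msym v^-1)) !mulrA.
(* Longer permutations have zero coefficient by induction; every other one distinct from [w0] has no
   [w0] term by triangularity. *)
have {}G0 : \sum_(k <- s | k.1 == w0) c k *: T k w0 = 0.
  rewrite -[RHS]G0 [LHS]big_mkcond [RHS]big_mkcond; apply: eq_big_seq => k ks'.
  case: (eqVneq k.1 w0) => [->|kw]; first by rewrite eqxx.
  case: ifP => // _; case: (ltnP (len w0) (len k.1)) => [/(c_long _ ks') ->|lw].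
    by rewrite scale0r.
  have [_ _ C_supp _] := DC k.1.
  have [Ck|/C_supp[Cl Cl']] := eqVneq (C k.1 w0) 0.
    by rewrite /T Ck mulr0 mul0r scaler0.
  by rewrite Cl' ?eqxx // in kw; apply/eqP; rewrite eqn_leq Cl lw.
(* The remaining terms share a nonzero factor and the automorphism by the inverse of [w0]; removing
   both leaves a relation between distinct monomials. *)
have {}G0 : \sum_(k <- s | k.1 == w0) c k *: 'X_[k.2] = 0 :> {mpoly F[d]}.
  have [_ _ _ C0] := DC w0.
  apply: (@inj_msym _ _ w0^-1); rewrite msym0; apply: (mulfI (mulf_neq0 (den'0 w0) C0)).
  rewrite mulr0 -[RHS]G0 linear_sum mulr_sumr; apply: eq_bigr => k /eqP kw.
  by rewrite linearZ /= -scalerAr /T kw.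
have := congr1 (mcoeff m0) G0; rewrite mcoeff0 raddf_sum big_mkcond /=.
rewrite (bigD1_seq (w0, m0)) //= eqxx mcoeffZ mcoeffX eqxx mulr1 big1 ?addr0 //.
move=> [w m] ne /=; case: (eqVneq w w0) ne => [->|//] ne.
by rewrite mcoeffZ mcoeffX xpair_eqE eqxx /= in ne *; rewrite (negPf ne) mulr0.
Qed.

Lemma red_elt_corner i j k :
  Seq_act k.1 i == j -> klr_corner K j i (red_elt i k).
Proof.
move=> /eqP ki; exists (red_elt i k).
have e_red : klr_e K j * red_elt i k = red_elt i k.
  by rewrite -ki -{1}(red_prod hred k.1); exact: word_elt_idem.
by rewrite e_red /red_elt /word_elt -[RHS]mulrA klr_eM eqxx.
Qed.

Lemma lspan_right_idem i (u : R) :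
  lspan (fun y : R => exists2 k, predT k & y = red_elt i k) (u * klr_e K i).
Proof.
elim: (klr_reduced_span hred u) => {u} [_ [w [m [i' ->]]]||c u v _ Su _ Sv].
- rewrite /word_elt -mulrA klr_eM; case: eqP => [->|_].
    by apply: LspanGen; exists (w, m).
  by rewrite mulr0; exact: LspanZero.
- by rewrite mul0r; exact: LspanZero.
- by rewrite mulrDl -klr_scalerAl; exact: LspanLin.
Qed.

Lemma red_elt_spans i j (u : R) : klr_corner K j i u ->
  lspan (fun y : R => exists2 k, Seq_act k.1 i == j & y = red_elt i k) u.
Proof.
move=> [b ->]; rewrite -mulrA; apply: lspan_mull (lspan_right_idem i b).
move=> _ [k _ ->]; rewrite /red_elt e_word_elt (red_prod hred).
case: eqP => [->|_]; last exact: LspanZero.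
by apply: LspanGen; exists k.
Qed.

Lemma word_elt_homogeneous a m i : klr_homogeneous (word_elt K a m i).
Proof.
elim: a => [|t a [n IH]]; last first.
  exists (- root_form D (tnth (Seq_act (expr_prod a) i) (pos t))
                      (tnth (Seq_act (expr_prod a) i) (posS t)) + n).
  rewrite word_elt_cons -word_elt_idem mulrA.
  by apply: klr_deg_mul IH; exact: klr_deg_tau.
suff [n Hn] : exists n, klr_deg n (klr_x_mon K m * klr_e K i).
  by exists n; rewrite word_elt_nil.
rewrite /klr_x_mon.
(* Degrees are assigned to [x_k 1_i] and not to [x_k], so invariance under [klr_e K i] is carried
   along to insert an idempotent after each new factor. *)
suff [] : klr_e K i * (\prod_k klr_x K k ^+ m k * klr_e K i)
    = \prod_k klr_x K k ^+ m k * klr_e K i /\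
    exists n, klr_deg n (\prod_k klr_x K k ^+ m k * klr_e K i) by [].
elim/big_rec: _ => [|k u _ IH].
  by rewrite mul1r klr_eM eqxx; split=> //; exists 0; exact: klr_deg_e.
rewrite -mulrA; elim: (m k) => [|n [e_v [p Hp]]]; first by rewrite expr0 mul1r.
rewrite exprS -mulrA; split; first by rewrite mulrA -klr_xE -mulrA e_v.
exists (2 * (cartan_sym D (tnth i k))%:Z + p); rewrite -e_v mulrA.
by apply: klr_deg_mul Hp; exact: klr_deg_x.
Qed.

Lemma pol_rep_faithful : faithful_rep rho.
Proof.
have [_ rho_lin _ rhoM] := pol_rep_is_representation K hprec alpha.
move=> a rho_a; rewrite -[a]mulr1 -[X in a * X]klr_e_sum mulr_sumr big1 // => i _.
have [s [c [us _ E]]] := lspan_family (lspan_right_idem i a).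
have c0 : {in s, forall k, c k = 0}.
  by apply: (red_elt_independent (i := i) us) => f; rewrite -E rhoM rho_a.
by rewrite E big_seq big1 // => k /c0 ->; rewrite scale0r.
Qed.

End Basis.

Theorem proposition2p4
    (F : fieldType) (I : countType) (D : cartan_datum I) (K : klr_datum F D)
    (prec : rel I) (hprec : strict_total_order prec)
    (alpha : {mset I})
    (red : 'S_(height alpha) -> seq 'I_(height alpha).-1)
    (hred : forall w, reduced_expr w (red w)) :
  (forall i j : Seq alpha,
     let B (wm : 'S_(height alpha) * 'X_{1..height alpha}) :=
       Seq_act wm.1 i == j in
     let b (wm : 'S_(height alpha) * 'X_{1..height alpha}) : klr K alpha :=
       klr_tau_word K (red wm.1) * klr_x_mon K wm.2 * klr_e K i in
     is_basis (klr_corner K j i) B b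
     /\ forall wm, B wm -> klr_homogeneous (b wm))
  /\
  (exists rho : klr K alpha -> Pol F alpha -> Pol F alpha,
     [/\ is_representation rho, pol_action prec rho & faithful_rep rho]).
Proof.
split=> [i j B b|]; last first.
  exists (@pol_rep F I D K prec alpha); split.
  - exact: pol_rep_is_representation.
  - exact: pol_rep_action.
  - exact: (@pol_rep_faithful F I D K prec hprec alpha red hred).
split; last by move=> wm _; exact: word_elt_homogeneous.
split.
- by move=> k; exact: red_elt_corner.
- move=> s c us _ sum0; apply: (red_elt_independent (K := K) hprec hred us) => f.
  have [_ rho_lin _ _] := pol_rep_is_representation K hprec alpha.
  (* As before, linearity at zero with scalar -1 shows that the zero of the algebra acts as zero. *)
  have rho0 := rho_lin (pol_in i f) (-1) 0 0.
  rewrite scaler0 addr0 scaleN1r addNr in rho0.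
  exact: etrans (congr1 (fun u => pol_rep prec u (pol_in i f)) sum0) rho0.
- by move=> v /(red_elt_spans hred)/lspan_family[s [c [_ sB ->]]]; exists s, c.
Qed.
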